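(* Let $B>1$, $1<\gamma\le 2$ and $C\ge 0$ be constants, and let $(p_j^{(1)})_{j\ge1}$ and $(p_j^{(2)})_{j\ge1}$ be sequences in $[0,1/2]$ such that $$\left|p_j^{(1)}-\frac{B}{4j}\right|\le\frac{C}{j^\gamma}\quad\text{and}\quad\left|p_j^{(2)}-\frac{B}{4j}\right|\le\frac{C}{j^\gamma},\qquad j=1,2,\ldots$$ Then on a suitable probability space one can construct nearest neighbor random walks $\{X_n^{(1)}\}_{n\ge0}$ and $\{X_n^{(2)}\}_{n\ge0}$ with parameters $p_j^{(1)}$ and $p_j^{(2)}$, respectively, such that as $n\to\infty$ $$|X_n^{(1)}-X_n^{(2)}|=O\big((X_n^{(1)}+X_n^{(2)})^{2-\gamma}\big)=O\big((n\log\log n)^{1-\gamma/2}\big)\qquad\text{almost surely.}$$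
   Context: A nearest neighbor (NN) random walk with parameters $p_i$ is a Markov chain $X_0=0,X_1,X_2,\ldots$ on the nonnegative integers with $\mathbf P(X_{n+1}=i+1\mid X_n=i)=1-\mathbf P(X_{n+1}=i-1\mid X_n=i)$, equal to $1$ if $i=0$ and to $1/2+p_i$ if $i\ge 1$. Almost sure $O(\cdot)$ statements allow a random implied constant. *)

(* Defs.v *)
From HB Require Import structures.
From mathcomp Require Import all_boot all_order all_algebra.
From mathcomp Require Import all_classical all_reals all_analysis.

Set Implicit Arguments.
Unset Strict Implicit.
Unset Printing Implicit Defensive.

Import Order.TTheory GRing.Theory Num.Theory.
Import numFieldNormedType.Exports.

Local Open Scope classical_set_scope.
Local Open Scope ring_scope.

(* P(A | B); it has the intended meaning only when P B != 0. *)
Definition cond_prob {d : measure_display} {T : measurableType d} {R : realType}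
    (P : probability T R) (A B : set T) : R :=
  fine (P (A `&` B)) / fine (P B).

Definition markov_chain {d : measure_display} {T : measurableType d}
    {R : realType} {P : probability T R} (X : nat -> {RV P >-> nat}) : Prop :=
  forall (n : nat) (x : nat -> nat) (j : nat),
    let past := [set w | forall k, (k <= n)%N -> X k w = x k] in
    P past != 0%E ->
    cond_prob P [set w | X n.+1 w = j] past =
    cond_prob P [set w | X n.+1 w = j] [set w | X n w = x n].

(* The value p 0 is never used. *)
Definition up_prob {R : realType} (p : nat -> R) (i : nat) : R :=
  if i == 0%N then 1 else 2^-1 + p i.

(* The event "X_(n+1) = i - 1" is written (X n.+1 w).+1 = i, so that it is empty
   for i = 0. *)
Definition nn_walk {d : measure_display} {T : measurableType d}
    {R : realType} {P : probability T R}
    (p : nat -> R) (X : nat -> {RV P >-> nat}) : Prop :=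
  [/\ forall w, X 0%N w = 0%N,
      markov_chain X &
      forall n i : nat, P [set w | X n w = i] != 0%E ->
        cond_prob P [set w | X n.+1 w = i.+1] [set w | X n w = i]
          = up_prob p i /\
        1 - cond_prob P [set w | (X n.+1 w).+1 = i] [set w | X n w = i]
          = up_prob p i].

(* Main.v *)
(* The shared-uniform coupling of the two walks does not give the pointwise
   bound: by the time X1 + X2 has dropped back from a high level, |X1 - X2| may
   still be of the order reached there.  The coupling below keeps |X1 - X2|
   bounded almost surely, which suffices, since X1 + X2 >= 1 whenever X1 and X2
   differ.

   Let p0(j) = min(B/(4j), 1/2).  Two walks with these nonincreasing parameters,
   driven by the same uniforms and started at points of equal parity, are never
   further apart than at the start.  Cut time into blocks.  Inside each block
   take such a pair started at the current positions, and couple its two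
   increment words optimally in total variation with the increment words of the
   p1-walk and of the p2-walk.  The distance of X1 and X2 can grow in a block
   only if one of these couplings fails.  The failure probability is controlled,
   through the Hellinger affinity, by the expected sum of (p_i - p0)^2 along the
   path; this is O(j^(-2 gamma)) at level j, and as B > 1 and gamma > 1 the
   function (x+1)^(-theta) with small theta > 0 is a Lyapunov function which
   absorbs it.  So a block started at x fails with a probability that is small
   when x is large, however long the block is.  The walks are transient, hence
   blocks starting late enough make the failure probabilities summable, and by
   Borel-Cantelli only finitely many blocks fail.

   The second estimate is the upper half of a law of the iterated logarithm, up
   to a constant; it comes from the exponential supermartingale built on
   cosh(lambda x). *)

Require Import Defs.
From HB Require Import structures.
From mathcomp Require Import all_boot all_order all_algebra.
From mathcomp Require Import all_classical all_reals all_analysis.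
From mathcomp Require Import ring lra zify.
Import Order.TTheory GRing.Theory Num.Theory.
Import numFieldNormedType.Exports.
Local Open Scope classical_set_scope.
Local Open Scope ring_scope.

Set Implicit Arguments.
Unset Strict Implicit.
Unset Printing Implicit Defensive.

(** * Words of increments *)

(* A down-step from 0 stays at 0; it has probability 0 (see step_prob). *)
Definition walk_step (x : nat) (b : bool) : nat := if b then x.+1 else x.-1.

Definition walk_pos (x : nat) (w : seq bool) : nat := foldl walk_step x w.

Fixpoint words (m : nat) : seq (seq bool) :=
  if m is m'.+1 then
    [seq true :: w | w <- words m'] ++ [seq false :: w | w <- words m']
  else [:: [::]].

Lemma mem_words m w : (w \in words m) = (size w == m).
Proof.
elim: m w => [|m IH] [|b w] //=; rewrite mem_cat.
  by apply/negbTE; rewrite negb_or; apply/andP; split; apply/mapP => -[].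
rewrite eqSS -IH; apply/idP/idP.
  by case/orP => /mapP[v vm [_ ->]].
by move=> wm; apply/orP; case: b; [left|right]; apply: map_f.
Qed.

Lemma uniq_words m : uniq (words m).
Proof.
elim: m => [|m IH] //=; rewrite cat_uniq !map_inj_uniq ?IH ?andbT//=;
  try by move=> ? ? [].
by apply/hasPn => w /mapP[v _ ->]; apply/mapP => -[].
Qed.

Lemma big_wordsS (R : realType) m (F : seq bool -> R) :
  \sum_(w <- words m.+1) F w =
  \sum_(w <- words m) F (true :: w) + \sum_(w <- words m) F (false :: w).
Proof. by rewrite /= big_cat !big_map. Qed.

Lemma walk_pos_cat x w v : walk_pos x (w ++ v) = walk_pos (walk_pos x w) v.
Proof. exact: foldl_cat. Qed.

Section Walk.
Variable R : realType.
Implicit Types (p : nat -> R) (f : nat -> R).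

Definition half_params p := forall j, (1 <= j)%N -> 0 <= p j <= 2^-1.

Definition step_prob p (x : nat) (b : bool) : R :=
  if b then up_prob p x else 1 - up_prob p x.

Fixpoint word_prob p (x : nat) (w : seq bool) : R :=
  if w is b :: w' then step_prob p x b * word_prob p (walk_step x b) w' else 1.

Definition transition p f (x : nat) : R :=
  step_prob p x true * f x.+1 + step_prob p x false * f x.-1.

Lemma up_prob_bnd p x : half_params p -> 2^-1 <= up_prob p x <= 1.
Proof.
move=> pp; rewrite /up_prob; case: eqP => [_|/eqP x0]; first by lra.
by have := pp x; rewrite lt0n x0 => /(_ isT); lra.
Qed.

Lemma step_prob_ge0 p x b : half_params p -> 0 <= step_prob p x b.
Proof. by move=> /(up_prob_bnd x); rewrite /step_prob; case: b; lra. Qed.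

Lemma step_prob_sum p x : step_prob p x true + step_prob p x false = 1.
Proof. by rewrite /step_prob /=; lra. Qed.

Lemma word_prob_ge0 p x w : half_params p -> 0 <= word_prob p x w.
Proof.
by move=> pp; elim: w x => [|b w IH] x //=; rewrite mulr_ge0// step_prob_ge0.
Qed.

Lemma word_prob_cat p x w v : word_prob p x (w ++ v) = word_prob p x w * word_prob p
    (walk_pos x w) v.
Proof. by elim: w x => [|b w IH] x /=; rewrite ?mul1r// IH mulrA. Qed.

(** Both sides are the expectation of [f] at time m for the walk started at x. Couplings are built
    on words, while estimates are made with the operator. *)
Lemma word_prob_iter p m f x :
  \sum_(w <- words m) word_prob p x w * f (walk_pos x w) = iter m (transition p) f x.
Proof.
elim: m x => [|m IH] x; first by rewrite big_seq1 mul1r.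
rewrite big_wordsS iterS /transition -!IH !big_distrr /=.
by congr (_ + _); apply: eq_bigr => w _; rewrite mulrA.
Qed.

Lemma transition_le p f g : half_params p -> (forall x, f x <= g x) ->
  forall x, transition p f x <= transition p g x.
Proof. by move=> pp fg x; rewrite lerD// ler_wpM2l// step_prob_ge0. Qed.

Lemma iter_transition_le p m f g : half_params p -> (forall x, f x <= g x) ->
  forall x, iter m (transition p) f x <= iter m (transition p) g x.
Proof. by move=> pp fg; elim: m => [|m IH] //=; apply: transition_le. Qed.

Lemma transition_cst p c x : transition p (fun=> c) x = c.
Proof. by rewrite /transition -mulrDl step_prob_sum mul1r. Qed.

Lemma iter_transition_cst p m c : iter m (transition p) (fun=> c) = fun=> c.
Proof. by elim: m => [|m IH] //=; rewrite IH; apply/funext => x;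
    rewrite transition_cst. Qed.

Lemma iter_transitionD p m f g x :
  iter m (transition p) (fun y => f y + g y) x = iter m (transition p) f x + iter m
      (transition p) g x.
Proof.
elim: m x => [|m IH] x //=; rewrite /transition !IH; ring.
Qed.

Lemma iter_transitionZ p m c f x :
  iter m (transition p) (fun y => c * f y) x = c * iter m (transition p) f x.
Proof. elim: m x => [|m IH] x //=; rewrite /transition !IH; ring. Qed.

Lemma word_prob_sum1 p m x : \sum_(w <- words m) word_prob p x w = 1.
Proof.
have := word_prob_iter p m (fun=> 1) x; rewrite iter_transition_cst => <-.
by apply: eq_bigr => w _; rewrite mulr1.
Qed.

End Walk.

(** * A Lyapunov function for the drift B/(4x) *)

Section Analytic.
Variable R : realType.
Implicit Types (h q a b z t u v : R).

(** For z <= 1 one has e^(-z) >= (1 - z/2)^2, and (1 - z/2)^2 (1 + z + 2 z^2) >= 1. *)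
Lemma expR_le_quad z : z <= 1 -> expR z <= 1 + z + 2 * z ^+ 2.
Proof.
move=> z1.
have h1 : 0 <= 1 - z / 2 by lra.
have h2 : 1 - z / 2 <= expR (- (z / 2)).
  by have := expR_ge1Dx (- (z / 2)); lra.
have h3 : (1 - z / 2) ^+ 2 <= expR (- z).
  rewrite (_ : - z = - (z / 2) + - (z / 2)); last by lra.
  by rewrite expRD -expr2 lerXn2r// nnegrE expR_ge0.
have h4 : 0 < (1 - z / 2) ^+ 2 by rewrite exprn_gt0//; lra.
rewrite -(ler_pM2l h4); apply: (@le_trans _ _ 1).
  have := expRxMexpNx_1 z; have := ler_wpM2r (expR_ge0 z) h3; lra.
(* This is (1 - z/2)^2 (1 + z + 2 z^2) - 1 in factored form. *)
have : 0 <= z ^+ 2 * ((1 - z) * (5 / 4 - z / 2)).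
  by rewrite mulr_ge0 ?sqr_ge0// mulr_ge0//; lra.
lra.
Qed.

Lemma ln_ge_1V t : 0 < t -> 1 - t^-1 <= ln t.
Proof.
move=> t0; have := @le_ln1Dx R (t^-1 - 1).
rewrite (_ : 1 + (t^-1 - 1) = t^-1); last by ring.
rewrite lnV ?posrE// => h.
have : -1 < t^-1 - 1 by have : 0 < t^-1 by [rewrite invr_gt0]; lra.
by move=> /h; lra.
Qed.

(* With y = 1/h, the two exponentials are the ratios of the values of y^(-th) at
   y + 1 and y - 1 to its value at y.  The first-order part of the drift, of size
   -(1 + dl) th h^2 / 2, beats the convexity term th (1 + th) h^2 / 2. *)
Lemma drift_quad th dl h q : 0 < th -> th <= 2^-1 -> th <= dl / 40 -> 0 < dl ->
  0 < h -> h <= 2^-1 -> h <= dl / (4 * (2 + dl)) ->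
  (1 + dl) * h / 4 <= q -> q <= 2^-1 ->
  (2^-1 + q) * expR (- th * ln (1 + h)) + (2^-1 - q) * expR (- th * ln (1 - h))
  <= 1 - th * dl / 4 * h ^+ 2.
Proof.
move=> th0 th2 thd dl0 h0 h2 hd qh q2.
have hd' : h * (4 * (2 + dl)) <= dl by rewrite -ler_pdivlMr//; lra.
set u := ln (1 + h); set v := ln (1 - h).
have u1 : u <= h by apply: le_ln1Dx; lra.
have u0 : h - h ^+ 2 <= u.
  have : 1 - (1 + h)^-1 <= u by apply: ln_ge_1V; lra.
  have -> : 1 - (1 + h)^-1 = h / (1 + h) by field; lra.
  apply: le_trans; rewrite ler_pdivlMr; last by lra.
  by have : 0 <= h ^+ 3 by [rewrite exprn_ge0//; lra]; lra.
have v1 : v <= - h by apply: le_ln1Dx; lra.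
have v0 : - (2 * h) <= v.
  have : 1 - (1 - h)^-1 <= v by apply: ln_ge_1V; lra.
  apply: le_trans; have -> : 1 - (1 - h)^-1 = - (h / (1 - h)) by field; lra.
  rewrite lerN2 ler_pdivrMr; last by lra.
  by nra.
(* The sum is estimated as ln (1 - h^2); adding the lower bounds [u0] and [v0] would leave an error
   of order h. *)
have uv : - (h ^+ 2 + 2 * h ^+ 4) <= u + v.
  have -> : u + v = ln (1 - h ^+ 2).
    by rewrite /u /v -lnM ?posrE; [congr ln; ring|lra|lra].
  have hh : h ^+ 2 <= 2^-1 by nra.
  have : 1 - (1 - h ^+ 2)^-1 <= ln (1 - h ^+ 2) by apply: ln_ge_1V; lra.
  apply: le_trans; have -> : 1 - (1 - h ^+ 2)^-1 = - (h ^+ 2 / (1 - h ^+ 2)).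
    by field; lra.
  rewrite lerN2 ler_pdivrMr; last by lra.
  have : 0 <= h ^+ 4 * (1 - 2 * h ^+ 2) by rewrite mulr_ge0 ?exprn_ge0//; lra.
  by lra.
have hh0 : 0 <= h ^+ 2 by rewrite sqr_ge0.
have thh0 : 0 <= th * h by rewrite mulr_ge0 ?ltW.
have hh1 : 0 <= h * (2^-1 - h) by apply: mulr_ge0; lra.
clearbody u v; set a := - th * u; set b := - th * v.
have A1 : 0 <= th * (h - u) by apply: mulr_ge0; lra.
have A2 : 0 <= th * (u - (h - h ^+ 2)) by apply: mulr_ge0; lra.
have A3 : 0 <= th * (- h - v) by apply: mulr_ge0; lra.
have A4 : 0 <= th * (v + 2 * h) by apply: mulr_ge0; lra.
have A5 : 0 <= th * (u + v + h ^+ 2 + 2 * h ^+ 4) by apply: mulr_ge0; lra.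
have A6 : 0 <= th * (h - h ^+ 2) by apply: mulr_ge0; lra.
have A7 : 0 <= h * (2^-1 - th) by apply: mulr_ge0; lra.
have A8 : 0 <= (2^-1 - th) * (th * h ^+ 2).
  by apply: mulr_ge0; [lra|apply: mulr_ge0; lra].
have a0 : a <= 0 by rewrite /a; lra.
have au : - (th * h) <= a by rewrite /a; lra.
have b0 : th * h <= b by rewrite /b; lra.
have bu : b <= 2 * (th * h) by rewrite /b; lra.
have ab : a + b <= th * (h ^+ 2 + 2 * h ^+ 4) by rewrite /a /b; lra.
have ba : th * (2 * h - h ^+ 2) <= b - a by rewrite /a /b; lra.
clear A1 A2 A3 A4 A5 A6; clearbody a b.
have a2 : a ^+ 2 <= th ^+ 2 * h ^+ 2.
  by rewrite -exprMn -(sqrrN a); apply: lerXn2r; rewrite ?nnegrE//; lra.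
have b2 : b ^+ 2 <= 4 * (th ^+ 2 * h ^+ 2).
  rewrite (_ : 4 * _ = (2 * (th * h)) ^+ 2); last by ring.
  by apply: lerXn2r; rewrite ?nnegrE//; lra.
have ea : expR a <= 1 + a + 2 * a ^+ 2 by apply: expR_le_quad; lra.
have eb : expR b <= 1 + b + 2 * b ^+ 2 by apply: expR_le_quad; lra.
have eb0 := expR_ge1Dx b.
have D : 2 * (th * h) * (1 - h) <= expR b - expR a by lra.
have D0 : 0 <= expR b - expR a.
  by apply: le_trans D; rewrite mulr_ge0//; lra.
have qD : (1 + dl) * h / 4 * (2 * (th * h) * (1 - h)) <= q * (expR b - expR a).
  apply: le_trans (_ : (1 + dl) * h / 4 * (expR b - expR a) <= _).
    apply: ler_wpM2l => //; apply: divr_ge0 => //; apply: mulr_ge0; lra.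
  exact: ler_wpM2r.
have S : (expR a + expR b) / 2 <= 1 + th * h ^+ 2 * (2^-1 + h ^+ 2 + 5 * th).
  lra.
(* Origin of the two smallness conditions: against -dl/2 stand 5 th <= dl/8, by [thd], and h^2 + (1
   + dl) h / 2 <= (2 + dl) h / 2 <= dl/8, by [hd]. *)
have br : 2^-1 + h ^+ 2 + 5 * th - (1 + dl) / 4 * (2 - 2 * h) <= - (dl / 4).
  lra.
have K : 0 <= th * h ^+ 2 by rewrite mulr_ge0// ltW.
have : th * h ^+ 2 * (2^-1 + h ^+ 2 + 5 * th - (1 + dl) / 4 * (2 - 2 * h))
   <= th * h ^+ 2 * - (dl / 4) by apply: ler_wpM2l.
lra.
Qed.

Lemma nat_ge_real (r : R) : exists n : nat, r <= n%:R.
Proof.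
exists (Num.truncn `|r|).+1.
by apply: le_trans (ler_norm r) _; apply/ltW; rewrite truncnS_gt.
Qed.

Lemma powR_large (e K : R) : 0 < e ->
  exists n : nat, forall x : nat, (n <= x)%N -> K <= x%:R `^ e.
Proof.
move=> e0; have [n nK] := nat_ge_real (`|K| `^ e^-1).
exists n => x nx; apply: le_trans (ler_norm K) _.
have -> : `|K| = (`|K| `^ e^-1) `^ e.
  by rewrite -powRrM mulVf ?lt0r_neq0// powRr1.
apply: ge0_ler_powR; rewrite ?nnegrE ?powR_ge0 ?ler0n//; first exact: ltW.
by apply: le_trans nK _; rewrite ler_nat.
Qed.

End Analytic.

(** * Couplings of increment words *)

(* The new coupling keeps the fraction min(a0, a1) / a0 of rho, and fills in the
   excess of a1 over a0 independently of the mass thereby freed on the other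
   side. *)
Lemma replace_marginal (R : realType) (A B : eqType) (l : seq A) (l' : seq B)
    (rho : A -> B -> R) (a0 a1 : A -> R) (b0 : B -> R) :
  (forall x y, 0 <= rho x y) -> (forall x, 0 <= a0 x) -> (forall x, 0 <= a1 x) ->
  \sum_(x <- l) a0 x = 1 -> \sum_(x <- l) a1 x = 1 ->
  (forall x, x \in l -> \sum_(y <- l') rho x y = a0 x) ->
  (forall y, y \in l' -> \sum_(x <- l) rho x y = b0 y) ->
  exists rho' : A -> B -> R, [/\ forall x y, 0 <= rho' x y,
    forall x, x \in l -> \sum_(y <- l') rho' x y = a1 x,
    forall y, y \in l' -> \sum_(x <- l) rho' x y = b0 y &
    forall bad : A -> B -> bool,
      \sum_(x <- l) \sum_(y <- l' | bad x y) rho' x y <=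
      \sum_(x <- l) \sum_(y <- l' | bad x y) rho x y
      + \sum_(x <- l) `|a1 x - a0 x|].
Proof.
move=> rho0 a00 a10 sa0 sa1 m1 m2.
(* [g] is the fraction kept, [dl] the excess of [a1], [r] the mass freed on the other side, and [Z]
   the common total of [dl] and [r]. *)
pose mn x := Num.min (a1 x) (a0 x).
pose g x := mn x / a0 x.
pose dl x := a1 x - mn x.
pose r y := \sum_(x <- l) rho x y * (1 - g x).
pose Z := \sum_(x <- l) dl x.
have mn0 x : 0 <= mn x by rewrite le_min a10 a00.
have g0 x : 0 <= g x by rewrite divr_ge0.
have ag x : a0 x * g x = mn x.
  rewrite /g mulrC; have [E|N0] := eqVneq (a0 x) 0; last by rewrite divfK.
  by rewrite E mulr0 /mn E; apply/esym/min_idPr.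
have g1 x : g x <= 1.
  rewrite /g; have [E|N0] := eqVneq (a0 x) 0; first by rewrite E invr0 mulr0.
  by rewrite ler_pdivrMr ?mul1r ?ge_min ?lexx ?orbT// lt_neqAle eq_sym N0 a00.
have dl0 x : 0 <= dl x by rewrite subr_ge0 /mn ge_min lexx.
have r0 y : 0 <= r y.
  by apply: sumr_ge0 => x _; rewrite mulr_ge0// subr_ge0.
have Z0 : 0 <= Z by apply: sumr_ge0.
have sr : \sum_(y <- l') r y = Z.
  have -> : Z = \sum_(x <- l) (a0 x - mn x) by rewrite /Z /dl !sumrB sa1 sa0.
  rewrite exchange_big big_seq [RHS]big_seq.
  by apply: eq_bigr => x xl; rewrite -big_distrl /= m1// mulrBr mulr1 ag.
(* If Z = 0 the quotient is 0 by convention, which is the right value because [dl] and [r] then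
   vanish. *)
have ZK c : (Z = 0 -> c = 0) -> c * Z / Z = c.
  have [->|ZN] := eqVneq Z 0; first by move=> ->//; rewrite !mul0r.
  by move=> _; rewrite mulfK.
have dlZ x : x \in l -> Z = 0 -> dl x = 0.
  move=> xl /eqP; rewrite /Z psumr_eq0// => /allP/(_ _ xl)/implyP/(_ isT).
  by move/eqP.
have rZ y : y \in l' -> Z = 0 -> r y = 0.
  move=> yl /eqP; rewrite -sr psumr_eq0// => /allP/(_ _ yl)/implyP/(_ isT).
  by move/eqP.
exists (fun x y => rho x y * g x + dl x * r y / Z); split.
- by move=> x y; rewrite addr_ge0// ?divr_ge0// mulr_ge0.
- move=> x xl; rewrite big_split /= -big_distrl /= m1// ag.
  rewrite -big_distrl -big_distrr /= sr ZK; last exact: dlZ.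
  by rewrite /dl addrC subrK.
- move=> y yl; rewrite big_split /= -big_distrl -big_distrl /= -/Z.
  rewrite [Z * _]mulrC ZK; last exact: rZ.
  rewrite -big_split /= -m2//; apply: eq_bigr => x _; ring.
- move=> bad.
  have -> : \sum_(x <- l) \sum_(y <- l' | bad x y) (rho x y * g x + dl x * r y / Z) =
    \sum_(x <- l) \sum_(y <- l' | bad x y) rho x y * g x +
    \sum_(x <- l) \sum_(y <- l' | bad x y) dl x * r y / Z.
    by rewrite -big_split; apply: eq_bigr => x _; rewrite -big_split.
  rewrite lerD//.
    apply: ler_sum => x _; apply: ler_sum => y _.
    by rewrite ler_piMr.
  apply: (@le_trans _ _ (\sum_(x <- l) dl x)); last first.
    apply: ler_sum => x _; have := ler_norm (a1 x - a0 x).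
    have := normr_ge0 (a1 x - a0 x); rewrite /dl /mn.
    by case: (leP (a1 x) (a0 x)) => _; lra.
  rewrite big_seq [leRHS]big_seq; apply: ler_sum => x xl.
  apply: (@le_trans _ _ (\sum_(y <- l') dl x * r y / Z)).
    rewrite [leRHS](bigID (bad x)) /= lerDl; apply: sumr_ge0 => y _.
    by rewrite divr_ge0// mulr_ge0.
  by rewrite -big_distrl -big_distrr /= sr ZK//; exact: dlZ.
Qed.

(** Truncated subtraction makes one summand zero, so this is |x - y|. *)
Definition gap (x y : nat) : nat := (x - y + (y - x))%N.

(** The bound is tested at every prefix, since the distance has to be controlled at all times inside
    a block. *)
Fixpoint stay_close (D x y : nat) (w v : seq bool) : bool :=
  (gap x y <= D)%N &&
  match w, v with
  | b :: w', c :: v' => stay_close D (walk_step x b) (walk_step y c) w' v'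
  | _, _ => true
  end.

Lemma stay_close_take D x y w v i : size w = size v -> stay_close D x y w v ->
  (gap (walk_pos x (take i w)) (walk_pos y (take i v)) <= D)%N.
Proof.
elim: w v x y i => [|b w IH] [|c v] x y [|i] //=; try by rewrite /= andbT.
  by move=> _ /andP[].
by move=> [sz] /andP[_ /IH]; apply.
Qed.

(** * Monotone coupling of two walks with the same parameters *)

Section MonotoneCoupling.
Variables (R : realType) (p : nat -> R).
Hypothesis pp : half_params p.
Hypothesis p_mono : forall i j, (1 <= i)%N -> (i <= j)%N -> p j <= p i.

(* Both walks step up exactly when a common uniform is below their up_prob. *)
Definition mono_step (x y : nat) (b c : bool) : R :=
  let u := up_prob p x in let v := up_prob p y in
  let m := Num.min u v in
  match b, c with
  | true, true => m
  | true, false => u - m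
  | false, true => v - m
  | false, false => 1 - Num.max u v
  end.

Fixpoint mono_coupling (x y : nat) (w v : seq bool) : R :=
  match w, v with
  | b :: w', c :: v' => mono_step x y b c * mono_coupling (walk_step x b) (walk_step
      y c) w' v'
  | _, _ => 1
  end.

Lemma up_prob_mono x y : (x <= y)%N -> up_prob p y <= up_prob p x.
Proof.
case: x => [|x] xy; first by rewrite [leRHS]/up_prob /=; case/andP: (up_prob_bnd y pp).
case: y xy => [//|y] xy; rewrite /up_prob /=.
by have := p_mono (ltn0Sn x) xy; lra.
Qed.

Lemma mono_step_ge0 x y b c : 0 <= mono_step x y b c.
Proof.
have := up_prob_bnd x pp; have := up_prob_bnd y pp.
by rewrite /mono_step /=; case: b; case: c; case: (leP (up_prob p x) (up_prob p y));
    lra.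
Qed.

Lemma mono_coupling_ge0 x y w v : 0 <= mono_coupling x y w v.
Proof.
by elim: w v x y => [|b w IH] [|c v] x y //=; rewrite mulr_ge0// mono_step_ge0.
Qed.

Lemma mono_coupling_left m x y w : w \in words m ->
    \sum_(v <- words m) mono_coupling x y w v = word_prob p x w.
Proof.
elim: m x y w => [|m IH] x y [|b w]; rewrite ?mem_words// => wm.
  by rewrite big_seq1.
have wm' : w \in words m by rewrite mem_words -eqSS.
rewrite big_wordsS /= -!big_distrr /= !IH// -mulrDl; congr (_ * _).
rewrite /mono_step /step_prob; case: b {wm} => /=; last first.
  by case: (leP (up_prob p x) (up_prob p y)) => _; lra.
by case: (leP (up_prob p x) (up_prob p y)) => _; lra.
Qed.

Lemma mono_coupling_right m x y v : v \in words m ->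
    \sum_(w <- words m) mono_coupling x y w v = word_prob p y v.
Proof.
elim: m x y v => [|m IH] x y [|c v]; rewrite ?mem_words// => vm.
  by rewrite big_seq1.
have vm' : v \in words m by rewrite mem_words -eqSS.
rewrite big_wordsS /= -!big_distrr /= !IH// -mulrDl; congr (_ * _).
rewrite /mono_step /step_prob; case: c {vm} => /=; last first.
  by case: (leP (up_prob p x) (up_prob p y)) => _; lra.
by case: (leP (up_prob p x) (up_prob p y)) => _; lra.
Qed.

(** Equal parity prevents crossing. Opposite moves occur only when the lower walk, having the larger
    [up_prob], goes up and the upper one goes down; their distance is then at least 2. *)
Lemma mono_step_gap x y b c : odd x = odd y -> mono_step x y b c != 0 ->
  odd (walk_step x b) = odd (walk_step y c) /\ (gap (walk_step x b) (walk_step y c)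
      <= gap x y)%N.
Proof.
move=> oxy; rewrite /mono_step /gap; case: b; case: c => /=.
- by move=> _; rewrite oxy; split=> //; lia.
- move=> h; have xy : (x < y)%N.
    rewrite ltnNge; apply/negP => /up_prob_mono h'; move: h.
    by rewrite (min_idPl h') subrr eqxx.
  by split; lia.
- move=> h; have xy : (y < x)%N.
    rewrite ltnNge; apply/negP => /up_prob_mono h'; move: h.
    by rewrite (min_idPr h') subrr eqxx.
  by split; lia.
(* A joint down-step has mass 0 as soon as one of the walks is at 0, where it would break the
   parity. *)
- have up0 : up_prob p 0 = 1 by [].
  case: x oxy => [|x].
    by rewrite up0 (max_idPl _) ?subrr ?eqxx//; case/andP: (up_prob_bnd y pp).
  case: y => [|y].
    by rewrite up0 (max_idPr _) ?subrr ?eqxx//; case/andP: (up_prob_bnd x.+1 pp).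
  by move=> oxy _ /=; split; lia.
Qed.

Lemma mono_coupling_close D x y w v : odd x = odd y -> (gap x y <= D)%N ->
  mono_coupling x y w v != 0 -> stay_close D x y w v.
Proof.
elim: w v x y => [|b w IH] [|c v] x y oxy xyD //=; rewrite xyD//=.
rewrite mulf_eq0 negb_or => /andP[/(mono_step_gap oxy)[oxy' d'] h].
by apply: IH => //; apply: leq_trans xyD.
Qed.

End MonotoneCoupling.

(** Twice the total variation distance between the laws of the first m increments. *)
Definition law_dist (R : realType) (p q : nat -> R) m x : R :=
  \sum_(w <- words m) `|word_prob p x w - word_prob q x w|.

(** The monotone coupling of two [p0]-walks gives no mass to pairs that drift apart. Its two
    marginals are replaced in turn, and each replacement adds at most one [law_dist] to the bad
    mass. *)
Lemma block_coupling (R : realType) (p0 p1 p2 : nat -> R) m x y :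
  half_params p0 -> half_params p1 -> half_params p2 ->
  (forall i j, (1 <= i)%N -> (i <= j)%N -> p0 j <= p0 i) ->
  exists J : seq bool -> seq bool -> R, [/\ forall w v, 0 <= J w v,
    forall w, w \in words m -> \sum_(v <- words m) J w v = word_prob p1 x w,
    forall v, v \in words m -> \sum_(w <- words m) J w v = word_prob p2 y v &
    odd x = odd y ->
      \sum_(w <- words m) \sum_(v <- words m | ~~ stay_close (gap x y) x y w v) J w v
        <= law_dist p1 p0 m x + law_dist p2 p0 m y].
Proof.
move=> pp0 pp1 pp2 mono.
have [J1 [J10 J1l J1r J1b]] := replace_marginal (mono_coupling_ge0 pp0 x y)
  (fun w => word_prob_ge0 x w pp0) (fun w => word_prob_ge0 x w pp1) (word_prob_sum1
      p0 m x)
  (word_prob_sum1 p1 m x) (fun w => mono_coupling_left p0 x y (w := w)) (fun v =>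
      mono_coupling_right p0 x y (v := v)).
have [J2 [J20 J2l J2r J2b]] := replace_marginal (fun w v => J10 v w)
  (fun w => word_prob_ge0 y w pp0) (fun w => word_prob_ge0 y w pp2) (word_prob_sum1
      p0 m y)
  (word_prob_sum1 p2 m y) J1r J1l.
exists (fun w v => J2 v w); split=> // oxy.
have swap (F : seq bool -> seq bool -> R) :
    \sum_(w <- words m) \sum_(v <- words m | ~~ stay_close (gap x y) x y w v) F w v =
    \sum_(v <- words m) \sum_(w <- words m | ~~ stay_close (gap x y) x y w v) F w v.
  under eq_bigr do rewrite big_mkcond.
  rewrite exchange_big /=; apply: eq_bigr => v _.
  by rewrite [RHS]big_mkcond.
rewrite swap; apply: le_trans (J2b (fun v w => ~~ stay_close (gap x y) x y w v)) _.
rewrite lerD2r -swap; apply: le_trans (J1b _) _; rewrite /law_dist -[leRHS]add0r lerD2r.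
rewrite big1// => w _; rewrite big1// => v h.
by apply/eqP; apply: contraNT h; apply: mono_coupling_close.
Qed.

(** * Hellinger bounds *)

Section Drift.
Variable R : realType.
Implicit Types (p q : nat -> R) (th dl : R).

(** The shift keeps the base positive; the value at 0 is 1. *)
Definition lyap th (x : nat) : R := x.+1%:R `^ (- th).

Lemma lyap_gt0 th x : 0 < lyap th x.
Proof. by rewrite powR_gt0. Qed.

Lemma lyap_le th x y : 0 <= th -> (x <= y)%N -> lyap th y <= lyap th x.
Proof.
move=> th0 xy; rewrite /lyap !powRN lef_pV2 ?posrE ?powR_gt0//.
by apply: ge0_ler_powR; rewrite ?nnegrE// ler_nat.
Qed.

Lemma lyap_small th e : 0 < th -> 0 < e ->
  exists n, forall x, (n <= x)%N -> lyap th x <= e.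
Proof.
move=> th0 e0; have [n nP] := powR_large (e^-1) th0.
exists n => x nx; rewrite /lyap powRN -[leRHS]invrK lef_pV2 ?posrE ?powR_gt0
    ?invr_gt0//.
exact/nP/leqW.
Qed.

Lemma powR_expln (a th : R) : 0 < a -> a `^ th = expR (th * ln a).
Proof. by move=> a0; rewrite /powR gt_eqF. Qed.

(** Taken at x + 1, this and [lyap_pred] at x produce the two exponentials of [drift_quad] with h =
    1/(x + 2). *)
Lemma lyap_succ th x :
  lyap th x.+1 = lyap th x * expR (- th * ln (1 + x.+1%:R^-1)).
Proof.
rewrite /lyap -powR_expln; last by rewrite ltr_wpDr.
rewrite -powRM// ?addr_ge0//; congr (_ `^ _).
by rewrite mulrDr mulr1 mulfV ?pnatr_eq0// -natr1 addrC -natr1 addrC.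
Qed.

Lemma lyap_pred th x :
  lyap th x = lyap th x.+1 * expR (- th * ln (1 - x.+2%:R^-1)).
Proof.
have h : (x.+2%:R^-1 : R) < 1 by rewrite invf_lt1// ltr1n.
rewrite /lyap -powR_expln; last by rewrite subr_gt0.
rewrite -powRM// ?subr_ge0 ?ltW//; congr (_ `^ _).
by rewrite mulrBr mulr1 mulfV ?pnatr_eq0// -[x.+2%:R]natr1 addrK.
Qed.

Definition bessel_like B gamma C p := half_params p /\
  forall j : nat, (1 <= j)%N -> `|p j - B / (4 * j%:R)| <= C / (j%:R `^ gamma).

(** The condition is convex in the parameters. The averaged walk is the one whose drift enters the
    affinity bound. *)
Lemma bessel_like_avg B gamma C p q : bessel_like B gamma C p ->
    bessel_like B gamma C q ->
  bessel_like B gamma C (fun x => (p x + q x) / 2).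
Proof.
move=> [pp ph] [qp qh]; split=> j j1; first by have := pp j j1; have := qp j j1; lra.
have -> : (p j + q j) / 2 - B / (4 * j%:R) =
  (p j - B / (4 * j%:R)) / 2 + (q j - B / (4 * j%:R)) / 2 by lra.
apply: le_trans (ler_normD _ _) _; rewrite !normrM (ger0_norm (_ : 0 <= 2^-1))//.
by have := ph j j1; have := qh j j1; lra.
Qed.

(** Here B = 1 + 2 dl. As gamma > 1, the error C/x^gamma is below dl/(4x) for large x, which leaves
    p x >= (1 + dl)/(4x) for [drift_quad]. The threshold is uniform in p. *)
Lemma lyap_drift B gamma C th dl : 1 < B -> 1 < gamma -> 0 <= C ->
  dl = (B - 1) / 2 -> 0 < th -> th <= 2^-1 -> th <= dl / 40 ->
  exists x0 : nat, (1 <= x0)%N /\ forall p, bessel_like B gamma C p ->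
    forall x, (x0 <= x)%N ->
    transition p (lyap th) x <= lyap th x * (1 - th * dl / 4 * x.+1%:R^-1 ^+ 2).
Proof.
move=> B1 g1 C0 dlE th0 th2 thd.
have dl0 : 0 < dl by lra.
have [n1 n1P] := nat_ge_real ((dl / (4 * (2 + dl)))^-1).
have g1' : 0 < gamma - 1 by lra.
have [n2 n2P] := powR_large (4 * C / dl) g1'.
exists (maxn 1 (maxn n1 n2)); split; first by rewrite leq_max.
move=> p [pp pB] [|x]; rewrite !geq_max //= => /andP[xn1 xn2].
have sx0 : 0 < (x.+1%:R : R) by rewrite ltr0n.
have px : (1 + dl) / 4 / x.+1%:R <= p x.+1.
  have := pB x.+1 isT; rewrite -(mulr_powRB1 (ltW sx0)); last by lra.
  move=> h; have : C / (x.+1%:R * x.+1%:R `^ (gamma - 1)) <= dl / 4 / x.+1%:R.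
    rewrite invfM mulrCA mulrC ler_wpM2r ?invr_ge0 ?ler0n//.
    rewrite ler_pdivrMr ?powR_gt0//.
    have := ler_wpM2l (ltW dl0) (n2P _ xn2).
    have -> : dl * (4 * C / dl) = 4 * C by field; rewrite gt_eqF.
    lra.
  have E : B / (4 * x.+1%:R) = (1 + 2 * dl) / 4 / x.+1%:R.
    by rewrite invfM mulrA; congr (_ / _); lra.
  move: h; rewrite E ler_norml => /andP[+ _].
  by move: (C / _) (x.+1%:R^-1) (p x.+1) => k z pz; lra.
have pp' := pp x.+1 isT.
rewrite /transition /step_prob /up_prob /= lyap_succ (lyap_pred th x).
set h := x.+2%:R^-1.
have h0 : 0 < h by rewrite invr_gt0 ltr0n.
have h2 : h <= 2^-1 by rewrite lef_pV2 ?posrE ?ltr0n// ler_nat.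
have hx : h <= x.+1%:R^-1 by rewrite lef_pV2 ?posrE ?ltr0n// ler_nat.
have hd : h <= dl / (4 * (2 + dl)).
  apply: le_trans hx _; rewrite -[leRHS]invrK lef_pV2 ?posrE//; last first.
    by rewrite invr_gt0 divr_gt0//; lra.
  by apply: le_trans n1P _; rewrite ler_nat.
have qh : (1 + dl) * h / 4 <= p x.+1.
  apply: le_trans px; have : 0 <= (1 + dl) / 4 by lra.
  by move=> d4; rewrite mulrAC; apply: ler_wpM2l.
have q2 : p x.+1 <= 2^-1 by lra.
have := drift_quad th0 th2 thd dl0 h0 h2 hd qh q2.
move/(ler_wpM2l (ltW (lyap_gt0 th x.+1))).
clearbody h; move: (expR _) (expR _) (lyap th x.+1) (p x.+1) => s r w q; lra.
Qed.

Lemma bessel_like_bnd B gamma C p j : 1 < B -> 1 < gamma -> 0 <= C ->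
  bessel_like B gamma C p -> (1 <= j)%N -> p j <= (B / 4 + C) / j%:R.
Proof.
move=> B1 g1 C0 [_ pB] j1; have := pB j j1.
have j0 : 0 < (j%:R : R) by rewrite ltr0n.
have : C / j%:R `^ gamma <= C / j%:R.
  apply: ler_wpM2l => //; rewrite lef_pV2 ?posrE ?powR_gt0//.
  by apply: le1r_powR; rewrite ?ler1n// ltW.
have -> : B / (4 * j%:R) = B / 4 / j%:R by rewrite invfM mulrA.
by rewrite ler_norml => h /andP[_ h']; lra.
Qed.

(** One minus the Hellinger affinity of the two one-step laws from x; [affinity] is the
    corresponding quantity for words. *)
Definition hellinger_defect p q x : R :=
  1 - (Num.sqrt (step_prob p x true * step_prob q x true)
       + Num.sqrt (step_prob p x false * step_prob q x false)).

(** With a and b the square roots, the left side is (a - b)^2 / 2, while s - r = (a - b)(a + b) and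
    a + b >= 1. *)
Lemma sqrt_defect (s r : R) : 4^-1 <= s -> 4^-1 <= r ->
  (s + r) / 2 - Num.sqrt (s * r) <= (s - r) ^+ 2 / 2.
Proof.
move=> s4 r4; have s0 : 0 <= s by lra. have r0 : 0 <= r by lra.
have h4 : Num.sqrt (4^-1) = 2^-1 :> R.
  by rewrite (_ : 4^-1 = 2^-1 ^+ 2) ?sqrtr_sqr ?ger0_norm//; lra.
have a2 : 2^-1 <= Num.sqrt s by rewrite -h4 ler_wsqrtr.
have b2 : 2^-1 <= Num.sqrt r by rewrite -h4 ler_wsqrtr.
rewrite sqrtrM// -{1 3}(sqr_sqrtr s0) -{1 3}(sqr_sqrtr r0).
move: (Num.sqrt s) (Num.sqrt r) a2 b2 => a b a2 b2.
have : (a - b) ^+ 2 * 1 <= (a - b) ^+ 2 * ((a + b) ^+ 2).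
  by apply: ler_wpM2l; rewrite ?sqr_ge0// exprn_ege1//; lra.
lra.
Qed.

(** [sqrt_defect] for the up-step and for the down-step; parameters up to 1/4 keep the
    down-probability at least 1/4. *)
Lemma hellinger_defect_le p q x : (1 <= x)%N -> 0 <= p x <= 4^-1 -> 0 <= q x <= 4^-1 ->
  hellinger_defect p q x <= (p x - q x) ^+ 2.
Proof.
case: x => // x _ px qx; rewrite /hellinger_defect /step_prob /up_prob /=.
have h1 : 4^-1 <= 2^-1 + p x.+1 by lra.
have h2 : 4^-1 <= 2^-1 + q x.+1 by lra.
have h3 : 4^-1 <= 1 - (2^-1 + p x.+1) by lra.
have h4 : 4^-1 <= 1 - (2^-1 + q x.+1) by lra.
have := sqrt_defect h1 h2; have := sqrt_defect h3 h4.
lra.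
Qed.

Definition affinity p q m x : R :=
  \sum_(w <- words m) Num.sqrt (word_prob p x w * word_prob q x w).

Lemma sqrt_amgm (s r : R) : 0 <= s -> 0 <= r -> Num.sqrt (s * r) <= (s + r) / 2.
Proof.
move=> s0 r0; rewrite sqrtrM// -{2}(sqr_sqrtr s0) -{2}(sqr_sqrtr r0).
by have := sqr_ge0 (Num.sqrt s - Num.sqrt r); lra.
Qed.

(* By AM-GM the geometric mean of the two kernels is dominated by the kernel with
   averaged parameters, so superharmonicity for that single walk is enough; where
   V >= 1 there is nothing to prove. *)
Lemma affinity_ge p q (V : nat -> R) m x : half_params p -> half_params q ->
  (forall x, 0 <= V x) ->
  (forall x, 1 <= V x \/
     transition (fun j => (p j + q j) / 2) V x + hellinger_defect p q x <= V x) ->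
  1 - affinity p q m x <= V x.
Proof.
move=> pp qp V0 HV; elim: m x => [|m IH] x.
  by rewrite /affinity big_seq1 /= mulr1 sqrtr1 subrr.
have [V1|HVx] := HV x.
  have : 0 <= affinity p q m.+1 x by apply: sumr_ge0 => w _; exact: sqrtr_ge0.
  by lra.
apply: le_trans HVx.
have -> : affinity p q m.+1 x =
    Num.sqrt (step_prob p x true * step_prob q x true) * affinity p q m x.+1
  + Num.sqrt (step_prob p x false * step_prob q x false) * affinity p q m x.-1.
  rewrite /affinity big_wordsS !big_distrr /=.
  congr (_ + _); apply: eq_bigr => w _; rewrite mulrACA sqrtrM//.
    by rewrite mulr_ge0//; [exact: (step_prob_ge0 x true pp)|exact: (step_prob_ge0 x
        true qp)].
  by rewrite mulr_ge0//; [exact: (step_prob_ge0 x false pp)|exact: (step_prob_ge0 x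
      false qp)].
have avgE b : step_prob (fun j => (p j + q j) / 2) x b = (step_prob p x b + step_prob
    q x b) / 2.
  by rewrite /step_prob /up_prob; case: b; case: eqP => _; lra.
rewrite /transition !avgE /hellinger_defect.
have := sqrt_amgm (step_prob_ge0 x true pp) (step_prob_ge0 x true qp).
have := sqrt_amgm (step_prob_ge0 x false pp) (step_prob_ge0 x false qp).
have := sqrtr_ge0 (step_prob p x true * step_prob q x true).
have := sqrtr_ge0 (step_prob p x false * step_prob q x false).
move: (Num.sqrt _) (Num.sqrt _) => s r s0 r0 s2 r2.
have := ler_wpM2l r0 (IH x.+1); have := ler_wpM2l s0 (IH x.-1).
have := ler_wpM2r (V0 x.+1) r2; have := ler_wpM2r (V0 x.-1) s2.
lra.
Qed.

(* AM-GM with a free weight t replaces Cauchy-Schwarz, so that the bound stays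
   linear in the defect v and can be averaged over the starting point. *)
Lemma law_dist_le p q (v t : R) m x : half_params p -> half_params q -> 0 < t ->
  1 - affinity p q m x <= v -> law_dist p q m x <= v / t + 2 * t.
Proof.
move=> pp qp t0 hv; rewrite /law_dist.
apply: (@le_trans _ _ (\sum_(w <- words m)
    ((word_prob p x w + word_prob q x w - 2 * Num.sqrt (word_prob p x w * word_prob q
        x w)) / (2 * t)
      + t * (word_prob p x w + word_prob q x w)))).
  apply: ler_sum => w _.
  have s0 := word_prob_ge0 x w pp; have r0 := word_prob_ge0 x w qp.
  rewrite sqrtrM//; move: (sqr_sqrtr s0) (sqr_sqrtr r0).
  move: (Num.sqrt (word_prob p x w)) (Num.sqrt (word_prob q x w)) (sqrtr_ge0
      (word_prob p x w)) (sqrtr_ge0 (word_prob q x w)).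
  move=> a b a0 b0 <- <-.
  rewrite subr_sqr normrM (ger0_norm (addr_ge0 a0 b0)).
  have -> : a ^+ 2 + b ^+ 2 - 2 * (a * b) = `|a - b| ^+ 2.
    by rewrite real_normK ?num_real//; ring.
  have := normr_ge0 (a - b); move: `|a - b| => d d0.
  rewrite -(ler_pM2l (_ : 0 < 2 * t)); last by lra.
  have -> : 2 * t * (d ^+ 2 / (2 * t) + t * (a ^+ 2 + b ^+ 2)) =
    d ^+ 2 + 2 * t ^+ 2 * (a ^+ 2 + b ^+ 2) by field; rewrite gt_eqF.
  have := sqr_ge0 (d - t * (a + b)); have := mulr_ge0 (sqr_ge0 t) (sqr_ge0 (a - b)).
  lra.
rewrite big_split /= -big_distrl -big_distrr /= sumrB big_split /= -big_distrr /=.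
rewrite !word_prob_sum1 -/(affinity p q m x).
have -> : 1 + 1 - 2 * affinity p q m x = (1 - affinity p q m x) * 2 by ring.
rewrite invfM mulrA mulfK// lerD ?ler_pM2r ?invr_gt0//; lra.
Qed.

(** [affinity_ge] is applied to a multiple of [lyap], whose drift absorbs the Hellinger defect at
    high levels. The bound does not depend on the length m. *)
Lemma law_dist_bound B gamma C th dl : 1 < B -> 1 < gamma -> gamma <= 2 -> 0 <= C ->
  dl = (B - 1) / 2 -> 0 < th -> th <= 2^-1 -> th <= dl / 40 ->
  th <= 2 * gamma - 2 ->
  exists2 K : R, 0 <= K & forall p q, bessel_like B gamma C p ->
      bessel_like B gamma C q ->
    forall m x t, 0 < t -> law_dist p q m x <= K * lyap th x / t + 2 * t.
Proof.
move=> B1 g1 g2 C0 dlE th0 th2 thd thg.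
have dl0 : 0 < dl by lra.
have [x0 [x01 x0P]] := lyap_drift B1 g1 C0 dlE th0 th2 thd.
have [n nP] := nat_ge_real (4 * (B / 4 + C)).
pose x1 := maxn x0 n.
pose c := th * dl / 4.
have c0 : 0 < c by rewrite divr_gt0// mulr_gt0.
(* The first summand makes K * [lyap] at least 1 up to level [x1]; the second lets the drift of K *
   [lyap] dominate the defect above [x1], where the parameters are at most 1/4. *)
pose K := (lyap th x1)^-1 + (2 * C) ^+ 2 * 16 / c.
have K0 : 0 <= K.
  by rewrite addr_ge0 ?invr_ge0 ?(ltW (lyap_gt0 _ _))// divr_ge0 ?(ltW c0)// mulr_ge0
      ?sqr_ge0.
exists K => // p q pN qN m x t t0.
apply: law_dist_le => //; [exact: pN.1|exact: qN.1|].
apply: (@affinity_ge p q (fun y => K * lyap th y)); [exact: pN.1|exact: qN.1| |].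
  by move=> y; rewrite mulr_ge0// ltW// lyap_gt0.
move=> y; case: (leqP y x1) => yx1; [left|right].
  rewrite mulrDl; apply: ler_wpDr.
    rewrite mulr_ge0 ?(ltW (lyap_gt0 _ _))// divr_ge0 ?(ltW c0)// mulr_ge0 ?sqr_ge0//.
  by rewrite ler_pdivlMl ?lyap_gt0// mulr1 lyap_le// ltW.
have yx0 : (x0 <= y)%N by apply: leq_trans (ltnW yx1); rewrite leq_maxl.
have yn : (n <= y)%N by apply: leq_trans (ltnW yx1); rewrite leq_maxr.
have y1 : (1 <= y)%N by apply: leq_trans yx0.
have y0 : 0 < (y%:R : R) by rewrite ltr0n.
have q4 p' : bessel_like B gamma C p' -> 0 <= p' y <= 4^-1.
  move=> pN'; have /andP[-> _] /= := pN'.1 y y1.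
  apply: le_trans (bessel_like_bnd B1 g1 C0 pN' y1) _.
  rewrite ler_pdivrMr//; have : 4 * (B / 4 + C) <= y%:R.
    by apply: le_trans nP _; rewrite ler_nat.
  lra.
have hE : hellinger_defect p q y <= (2 * C) ^+ 2 * (y%:R `^ gamma)^-1 ^+ 2.
  apply: le_trans (hellinger_defect_le y1 (q4 _ pN) (q4 _ qN)) _.
  have : `|p y - q y| <= 2 * C * (y%:R `^ gamma)^-1.
    have := pN.2 y y1; have := qN.2 y y1.
    by rewrite !ler_norml => /andP[h1 h2] /andP[h3 h4]; apply/andP; split; lra.
  move=> h; rewrite -exprMn -(real_normK (num_real (p y - q y))).
  by apply: lerXn2r; rewrite ?nnegrE ?normr_ge0//; apply: le_trans h.
have dr := x0P _ (bessel_like_avg pN qN) y yx0.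
have -> : transition (fun j => (p j + q j) / 2) (fun z => K * lyap th z) y =
    K * transition (fun j => (p j + q j) / 2) (lyap th) y by rewrite /transition; ring.
(* From y + 1 <= 2y comes the factor 2^(2 gamma) <= 16, and th + 2 <= 2 gamma compares the powers of
   1/(y + 1). *)
have Wh : (y%:R `^ gamma)^-1 ^+ 2 <= 16 * (lyap th y * y.+1%:R^-1 ^+ 2).
  have sy0 : 0 < (y.+1%:R : R) by rewrite ltr0n.
  have -> : (y%:R `^ gamma)^-1 ^+ 2 = (y%:R^-1) `^ (2 * gamma).
    rewrite -(powR_inv1 (ltW y0)) -powRrM mulN1r powRN exprVn; congr (_^-1).
    by rewrite -powR_mulrn ?powR_ge0// -powRrM mulrC.
  have -> : lyap th y * y.+1%:R^-1 ^+ 2 = (y.+1%:R^-1) `^ (th + 2).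
    rewrite powRD; last by apply/implyP => _; rewrite invr_eq0 gt_eqF.
    rewrite powR_mulrn ?invr_ge0 ?ler0n//; congr (_ * _).
    by rewrite /lyap -(powR_inv1 (ltW sy0)) -powRrM mulN1r.
  apply: (@le_trans _ _ ((2 * y.+1%:R^-1) `^ (2 * gamma))).
    apply: ge0_ler_powR; rewrite ?nnegrE ?mulr_ge0 ?invr_ge0 ?ler0n//; first by lra.
    rewrite -ler_pdivrMl// -invfM lef_pV2 ?posrE ?mulr_gt0//.
    by rewrite -natr1 mulr_natl mulr2n lerD2l ler1n.
  rewrite powRM ?invr_ge0 ?ler0n//.
  apply: ler_pM; rewrite ?powR_ge0//.
    apply: (@le_trans _ _ (2 `^ 4)); first by apply: ler_powR; lra.
    by rewrite powR_mulrn// -natrX ler_nat.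
  apply: ger_powR; last by lra.
  by rewrite invr_gt0 sy0 /= invf_le1// ler1n.
have KC : (2 * C) ^+ 2 * 16 <= K * c.
  have -> : K * c = (lyap th x1)^-1 * c + (2 * C) ^+ 2 * 16.
    by rewrite /K [LHS]mulrDl; congr (_ + _); rewrite divfK// gt_eqF.
  by rewrite lerDr mulr_ge0 ?(ltW c0)// invr_ge0 ltW// lyap_gt0.
have W0 : 0 <= lyap th y * y.+1%:R^-1 ^+ 2.
  by rewrite mulr_ge0 ?sqr_ge0// ltW// lyap_gt0.
have hK : hellinger_defect p q y <= K * c * (lyap th y * y.+1%:R^-1 ^+ 2).
  apply: le_trans hE (le_trans (ler_wpM2l (sqr_ge0 (2 * C)) Wh) _).
  by rewrite [leLHS]mulrA; apply: ler_wpM2r.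
apply: le_trans (lerD (ler_wpM2l K0 dr) hK) _; rewrite -/c.
rewrite le_eqVlt; apply/orP; left; apply/eqP; ring.
Qed.

End Drift.

(** * Transience *)

Section Transience.
Variables (R : realType) (p : nat -> R).
Hypothesis pp : half_params p.

Let occ (x n : nat) : R := iter n (transition p) (fun y => (y == x)%:R) 0%N.

Lemma iter_transition_succ f n : iter n.+1 (transition p) f 0%N = iter n (transition
    p) (transition p f) 0%N.
Proof. by rewrite iterSr. Qed.

Lemma occ_ge0 x n : 0 <= occ x n.
Proof.
have := @iter_transition_le _ p n (fun=> 0) (fun y => (y == x)%:R) pp.
by rewrite iter_transition_cst => h; apply: h => y; rewrite ler0n.
Qed.

(* The decrements of the nonincreasing sequence E V(X_n) tend to 0, and they are
   at least (V x - transition p V x) P(X_n = x). *)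
Lemma occ_super (V : nat -> R) x : (forall y, 0 <= V y) ->
  (forall y, transition p V y <= V y) -> transition p V x < V x -> occ x @ \oo -->
      (0 : R).
Proof.
move=> V0 PV PVx; pose a n := iter n (transition p) V 0%N.
have aS n : a n.+1 <= a n by rewrite /a iter_transition_succ; apply: iter_transition_le.
have a0 n : 0 <= a n.
  have := @iter_transition_le _ p n (fun=> 0) V pp V0 0%N.
  by rewrite iter_transition_cst.
have ca : cvgn a.
  apply: nonincreasing_is_cvgn; first exact/nonincreasing_seqP.
  by exists 0 => _ [n _ <-].
have da : (fun n => a n - a n.+1) @ \oo --> (0 : R).
  rewrite -(subrr (limn a)); apply: cvgB => //.
  by rewrite (cvg_shiftS a).
pose d := V x - transition p V x.
have d0 : 0 < d by rewrite subr_gt0.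
have dE n : occ x n <= d^-1 * (a n - a n.+1).
  rewrite mulrC ler_pdivlMr// mulrC -iter_transitionZ -subr_ge0.
  have -> : a n - a n.+1 - iter n (transition p) (fun y => d * (y == x)%:R) 0%N =
     iter n (transition p) (fun y => V y + (-1 * (transition p V y) + -1 * (d * (y ==
         x)%:R))) 0%N.
    by rewrite !iter_transitionD !iter_transitionZ /a iter_transition_succ; ring.
  have := @iter_transition_le _ p n (fun=> 0) (fun y =>
      V y + (-1 * (transition p V y) + -1 * (d * (y == x)%:R))) pp.
  rewrite iter_transition_cst => h; apply: h => y; have := PV y.
  by case: eqP => [->|_]; rewrite /d ?mulr1 ?mulr0; lra.
apply: (@squeeze_cvgr _ _ _ _ (fun=> 0) (fun n => d^-1 * (a n - a n.+1))).
- by apply: nearW => n; rewrite occ_ge0 dE.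
- exact: cvg_cst.
- by rewrite -(mulr0 d^-1); apply: cvgMr.
Qed.

(* From x the walk is at x + 1 after one step with probability at least 1/2. *)
Lemma occ_pred x : occ x.+1 @ \oo --> (0 : R) -> occ x @ \oo --> (0 : R).
Proof.
move=> h.
have E n : occ x n <= 2 * occ x.+1 n.+1.
  rewrite /occ iter_transition_succ -iter_transitionZ; apply: iter_transition_le =>
      // y.
  rewrite /transition eqSS; have := step_prob_ge0 y false pp; have := up_prob_bnd y pp.
  case: (y == x); case: (y.-1 == x.+1); rewrite /step_prob /=; lra.
apply: (@squeeze_cvgr _ _ _ _ (fun=> 0) (fun n => 2 * occ x.+1 n.+1)).
- by apply: nearW => n; rewrite occ_ge0 E.
- exact: cvg_cst.
- by rewrite -(mulr0 (2 : R)); apply: cvgMr; rewrite (cvg_shiftS (occ x.+1)).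
Qed.

Lemma occ_low N : (forall x, occ x @ \oo --> (0 : R)) ->
  (fun n => iter n (transition p) (fun y => (y < N)%:R) 0%N) @ \oo --> (0 : R).
Proof.
move=> h; elim: N => [|N IH].
  rewrite (_ : (fun n => _) = fun=> 0); first exact: cvg_cst.
  by apply/funext => n; rewrite (_ : (fun y => _) = fun=> 0) ?iter_transition_cst.
rewrite (_ : (fun n => _) = (fun n => iter n (transition p) (fun y =>
    (y < N)%:R) 0%N + occ N n)).
  by rewrite -(addr0 (0 : R)); apply: cvgD.
apply/funext => n; rewrite /occ -iter_transitionD; congr (iter n (transition p) _ _).
apply/funext => y; rewrite ltnS leq_eqVlt.
by case: eqP => [->|_]; rewrite ?ltnn ?add0r//= addr0.
Qed.

End Transience.

(** Made constant below [x0], the Lyapunov function is superharmonic everywhere and strictly so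
    above [x0]. Hence P(X_n = x) tends to 0 there, and then at every x by going down one level at a
    time. *)
Lemma transience (R : realType) (B gamma C th dl : R) p :
  1 < B -> 1 < gamma -> 0 <= C ->
  dl = (B - 1) / 2 -> 0 < th -> th <= 2^-1 -> th <= dl / 40 ->
      bessel_like B gamma C p ->
  (fun n => iter n (transition p) (lyap th) 0%N) @ \oo --> (0 : R).
Proof.
move=> B1 g1 C0 dlE th0 th2 thd pN; have pp := pN.1.
have [x0 [x01 x0P]] := lyap_drift B1 g1 C0 dlE th0 th2 thd.
have dl0 : 0 < dl by lra.
pose V x := lyap th (maxn x x0).
have V0 y : 0 <= V y by rewrite ltW// lyap_gt0.
have VW x : (x0 < x)%N -> transition p V x < V x.
  move=> xx0; have -> : transition p V x = transition p (lyap th) x.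
    by rewrite /transition /V !(maxn_idPl _)//; lia.
  apply: le_lt_trans (x0P _ pN _ (ltnW xx0)) _.
  rewrite /V (maxn_idPl (ltnW xx0)) gtr_pMr ?lyap_gt0// gtrBl.
  by rewrite mulr_gt0 ?divr_gt0 ?mulr_gt0// exprn_gt0// invr_gt0 ltr0n.
have PV x : transition p V x <= V x.
  have [xx0|xx0] := ltnP x0 x; first exact/ltW/VW.
  rewrite {2}/V (maxn_idPr xx0) -[leRHS](transition_cst p _ x);
      apply: transition_le => // y.
  by rewrite /V lyap_le ?leq_maxr// ltW.
have occ0 x : (fun n => iter n (transition p) (fun y => (y == x)%:R) 0%N) @ \oo -->
    (0 : R).
  (* The induction on k descends from the levels above [x0]. *)
  have [k kx] : exists k, (x0 < x + k)%N by exists x0.+1; lia.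
  elim: k x kx => [|k IH] x kx.
    by apply: (occ_super pp V0 PV); apply: VW; rewrite addn0 in kx.
  by apply: occ_pred => //; apply: IH; lia.
apply/cvgrPdist_le => e e0.
have [N NP] := lyap_small th0 (divr_gt0 e0 (ltr0n R 2)).
have /cvgrPdist_le/(_ _ (divr_gt0 e0 (ltr0n R 2))) := occ_low N occ0.
apply: filterS => n; rewrite !sub0r !normrN.
have i0 f : (forall y, 0 <= f y) -> 0 <= iter n (transition p) f 0%N.
  move=> f0; have := @iter_transition_le _ p n (fun=> 0) f pp f0 0%N.
  by rewrite iter_transition_cst.
rewrite !ger0_norm; try by apply: i0 => y; rewrite ?ler0n// ltW// lyap_gt0.
(* [lyap] is at most 1 below N and at most e/2 from N on. *)
move=> h; apply: (@le_trans _ _ (iter n (transition p) (fun y =>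
    (y < N)%:R + e / 2) 0%N)).
  apply: iter_transition_le => // y; case: ltnP => [_|/NP]; last by rewrite mulr0n; lra.
  rewrite mulr1n; have : lyap th y <= lyap th 0 by rewrite lyap_le// ltW.
  by rewrite {2}/lyap powR1; lra.
by rewrite iter_transitionD iter_transition_cst; lra.
Qed.

(** * Stochastic processes indexed by a tree *)

Section UnitProb.
Variable R : realType.

Definition unit_prob : set (measurableTypeR R) -> \bar R :=
  mrestr (@lebesgue_measure R) (measurable_itv `[0, 1[).

HB.instance Definition _ := Measure.on unit_prob.

Let unit_prob_setT : unit_prob setT = 1%E.
Proof.
by rewrite /unit_prob /mrestr setTI lebesgue_measure_itv /= lte_fin ltr01 sube0.
Qed.

HB.instance Definition _ := Measure_isProbability.Build _ _ _ unit_prob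
  unit_prob_setT.

End UnitProb.

Section TreeSpace.
Variables (R : realType) (N : eqType).

(** Inversion of the cumulative weights: the entry whose interval contains c, and the offset of c in
    it. The last entry takes all that is left. *)
Fixpoint descend_list (wt : N -> R) (a : N) (l : seq N) (c : R) : N * R :=
  if c < wt a then (a, c)
  else if l is b :: l' then descend_list wt b l' (c - wt a) else (a, c).

Lemma mem_descend_list wt a l c : (descend_list wt a l c).1 \in a :: l.
Proof.
elim: l a c => [|b l IH] a c /=; case: ifP => _ /=; rewrite ?mem_head//.
by rewrite in_cons IH orbT.
Qed.

(** The witness e is the total weight of the entries before s. *)
Lemma descend_listP wt a l s : uniq (a :: l) -> (forall b, 0 <= wt b) -> s \in a :: l ->
  exists e, [/\ 0 <= e, e + wt s <= \sum_(b <- a :: l) wt b &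
    forall c, 0 <= c < \sum_(b <- a :: l) wt b ->
      ((descend_list wt a l c).1 = s <-> e <= c < e + wt s) /\
      ((descend_list wt a l c).1 = s -> (descend_list wt a l c).2 = c - e)].
Proof.
move=> + wt0; elim: l a => [|b l IH] a /=.
  move=> _; rewrite inE => /eqP ->; exists 0; rewrite big_seq1 add0r; split=> // c.
  by move=> /andP[c0 ca]; rewrite ca c0 /= subr0.
move=> /andP[abl ubl]; rewrite big_cons inE => /orP[/eqP ->|sbl].
  exists 0; rewrite add0r lerDl sumr_ge0//; split=> // c /andP[c0 _].
  rewrite c0 /=; case: ltP => [|_]; first by rewrite subr0.
  by split=> [|/eqP]; [split=> // /eqP|]; move=> /eqP pa; move: abl;
    rewrite -pa mem_descend_list.
have [e [e0 es H]] := IH _ ubl sbl.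
exists (wt a + e); split; [by rewrite addr_ge0|by rewrite -addrA lerD2l|].
move=> c /andP[c0 cS]; case: ltP => [ca|ac] /=.
  have nas : a <> s by move=> E; move: abl; rewrite E sbl.
  split; last by move/nas.
  by split; [move/nas | clear nas => ?; exfalso; lra].
have [|H1 H2] := H (c - wt a); first by lra.
by split; [rewrite H1; split; lra|move=> /H2 ->; lra].
Qed.

Variables (r : N) (ch : nat -> N -> seq N) (wt : nat -> N -> N -> R).
Variable par : nat -> N -> N.
Hypothesis ch_uniq : forall k s, uniq (ch k s).
Hypothesis ch_par : forall k s s', s' \in ch k s -> par k s' = s.
Hypothesis wt_ge0 : forall k s s', 0 <= wt k s s'.
Hypothesis wt_sum : forall k s, \sum_(s' <- ch k s) wt k s s' = 1.

(* The nodes of level k correspond to disjoint subintervals of [0, 1[ whose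
   lengths are their masses.  A triple consists of the node whose interval
   contains u, the offset of u in that interval, and its length. *)
Let descend k (z : N * R * R) : N * R * R :=
  let: (s, c, m) := z in
  let: (s', c') := descend_list (fun b => m * wt k s b)
                        (head r (ch k s)) (behead (ch k s)) c in
  (s', c', m * wt k s s').

Let run (u : R) := fix run (k : nat) : N * R * R :=
  if k is k'.+1 then descend k' (run k') else (r, u, 1).

Let node k u := (run u k).1.1.

Let ch_head k s : ch k s = head r (ch k s) :: behead (ch k s).
Proof.
have := wt_sum k s; case: (ch k s) => //=.
by rewrite big_nil => /eqP; rewrite eq_sym oner_eq0.
Qed.

Let node_ch k u : node k.+1 u \in ch k (node k u).
Proof.
rewrite /node /=; case: (run u k) => [[s c] m] /=.
have := mem_descend_list (fun b => m * wt k s b)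
  (head r (ch k s)) (behead (ch k s)) c.
by rewrite -ch_head; case: descend_list.
Qed.

Let mass := fix mass (k : nat) (s : N) : R :=
  if k is k'.+1 then
    if s \in ch k' (par k' s) then mass k' (par k' s) * wt k' (par k' s) s else 0
  else (s == r)%:R.

Let mass_ge0 k s : 0 <= mass k s.
Proof.
elim: k s => [|k IH] s //=; case: ifP => // _; exact: mulr_ge0.
Qed.

(** The interval of s starts at that of its parent, shifted by the masses of the earlier siblings.
    Nodes that cannot be reached get an empty interval. *)
Let node_itv k s : let m := mass k s in exists e, [/\ 0 <= e, e + m <= 1 &
  forall u, 0 <= u < 1 -> (node k u = s <-> e <= u < e + m) /\
    (node k u = s -> run u k = (s, u - e, m))].
Proof.
elim: k s => [|k IH] s /=.
  have [->|rs] := eqVneq s r.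
    exists 0; rewrite add0r; split=> // u u01; split; first by rewrite u01.
    by rewrite subr0.
  exists 0; rewrite mulr0n addr0; split; rewrite ?ler01 //.
  move=> u _; have nrs : node 0 u <> s by move=> E; move: rs; rewrite -E eqxx.
  split; last by move/nrs.
  by split; [move/nrs | clear nrs => ?; exfalso; lra].
have [sch|nch] := boolP (s \in ch k (par k s)); last first.
  exists 0; rewrite addr0; split; rewrite ?ler01 //.
  move=> u _; have ns : node k.+1 u <> s.
    move=> E; move: nch; rewrite -E; have := node_ch k u.
    by move=> h; rewrite (ch_par h) h.
  split; last by move/ns.
  by split; [move/ns | clear ns => ?; exfalso; lra].
have [e [e0 em H]] := IH (par k s).
set q := par k s in sch e e0 em H *.
set m := mass k q in em H *; have m0 : 0 <= m := mass_ge0 k q.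
have := sch; rewrite ch_head => sch'.
have := ch_uniq k q; rewrite ch_head => uch.
have mw0 b : 0 <= m * wt k q b by rewrite mulr_ge0.
have [e' [e'0 e'm]] := descend_listP uch mw0 sch'.
rewrite -ch_head -big_distrr /= wt_sum mulr1 in e'm * => H'.
exists (e + e'); split; [by rewrite addr_ge0|lra|].
move=> u u01; have [H1 H2] := H u u01.
have nodeS : node k.+1 u = s -> node k u = q.
  by move=> E; rewrite /q -E (ch_par (node_ch k u)).
have runS : node k u = q -> 0 <= u - e < m /\
    run u k.+1 = let: (s', c') := descend_list (fun b => m * wt k q b)
                        (head r (ch k q)) (behead (ch k q)) (u - e) in
  (s', c', m * wt k q s').
  by move=> E; have /H1 := E; split; [lra|rewrite /= (H2 E)].
split.
  split=> [E|uee].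
    have [ue] := runS (nodeS E).
    have [K1 K2] := H' _ ue.
    move: E; rewrite /node => E RE; move: E; rewrite RE.
    by case: descend_list K1 K2 => s' c' /= K1 K2 /K1; lra.
  have E : node k u = q by apply/H1; lra.
  have [ue RE] := runS E.
  have [K1 K2] := H' _ ue.
  rewrite /node RE; case: descend_list K1 K2 => s' c' /= K1 K2; apply/K1; lra.
move=> E; have [ue RE] := runS (nodeS E).
have [K1 K2] := H' _ ue.
move: E; have -> : descend k (run u k) = run u k.+1 by [].
rewrite /node RE; case: descend_list K1 K2 => s' c' /= K1 K2 E.
by rewrite E K2//; congr (_, _, _); lra.
Qed.

(** One uniform variable carries the whole process. Since a node determines its parent, the laws at
    single levels determine the law of the path. *)
Lemma tree_space : exists (d : measure_display) (T : measurableType d)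
    (P : probability T R) (S : nat -> T -> N),
  [/\ forall u, S 0%N u = r,
      forall k u, S k.+1 u \in ch k (S k u),
      forall k s, measurable [set u | S k u = s] &
      forall k s s', s' \in ch k s ->
        P [set u | S k.+1 u = s'] = (P [set u | S k u = s] * (wt k s s')%:E)%E].
Proof.
(* Outside [0, 1[, a null set, the path of the point 0 is copied, so that the pathwise claims hold
   for every u. *)
pose S k u := if 0 <= u < 1 then node k u else node k 0.
have SE k s e m : 0 <= e -> e + m <= 1 ->
    (forall u, 0 <= u < 1 -> (node k u = s <-> e <= u < e + m)) ->
    [set u | S k u = s] `&` `[0, 1[%classic = `[e, e + m[%classic.
  move=> e0 em H; apply/seteqP; split=> u /=; rewrite /S !in_itv /=.
    by move=> [+ u01]; rewrite u01 => /(H _ u01).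
  by move=> uem; have u01 : 0 <= u < 1 by [lra]; rewrite u01; split=> //; apply/H.
have PS k s e m : 0 <= e -> 0 <= m -> e + m <= 1 ->
    (forall u, 0 <= u < 1 -> (node k u = s <-> e <= u < e + m)) ->
    unit_prob [set u | S k u = s] = m%:E.
  move=> e0 m0 em H; rewrite /unit_prob /mrestr (SE _ _ e m)//.
  rewrite lebesgue_measure_itv /= lte_fin; case: ltP => [_|].
    by rewrite -EFinB; congr EFin; lra.
  by move=> ?; congr EFin; lra.
exists _, _, (@unit_prob R), S; split.
- by move=> u; rewrite /S; case: ifP.
- by move=> k u; rewrite /S; case: ifP.
- move=> k s; have [e [e0 em H]] := node_itv k s.
  rewrite -[X in measurable X](setUIDK _ `[0, 1[%classic).
  apply: measurableU.
    by rewrite (SE _ _ e (mass k s))// => u /H[].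
  have [E|NE] := pselect (node k 0 = s).
    rewrite (_ : _ `\` _ = ~` `[0, 1[%classic); first exact: measurableC.
    apply/seteqP; split=> u /=; rewrite /S in_itv /=; first by case.
    by move=> h; split=> //; rewrite (negbTE (introN idP h)).
  rewrite (_ : _ `\` _ = set0); first exact: measurable0.
  apply/seteqP; split=> u //=; rewrite /S in_itv /= => -[].
  by move=> + h; rewrite (negbTE (introN idP h)).
- move=> k s s' ss'.
  have PE j q : unit_prob [set u | S j u = q] = (mass j q)%:E.
    have [e [e0 em H]] := node_itv j q.
    by apply: (PS _ _ e) => // u /H[].
  apply: etrans (PE k.+1 s') _; apply/esym.
  apply: etrans (congr1 (fun z => z * _)%E (PE k s)) _.
  by rewrite -EFinM /= (ch_par ss') ss'.
Qed.

End TreeSpace.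

(** * Laws of the component words *)

Lemma big_words_add (R : realType) n r (F : seq bool -> R) :
  \sum_(w <- words (n + r)) F w =
  \sum_(v <- words n) \sum_(z <- words r) F (v ++ z).
Proof.
elim: n F => [|n IH] F; first by rewrite big_seq1.
by rewrite addSn !big_wordsS !IH.
Qed.

(* The condition excludes down-steps from 0, which would not change the parity. *)
Lemma word_prob_odd (R : realType) (p : nat -> R) x w : word_prob p x w != 0 ->
  odd (walk_pos x w) = odd x (+) odd (size w).
Proof.
elim: w x => [|b w IH] x /=; first by rewrite addbF.
rewrite mulf_eq0 negb_or => /andP[s0 /IH ->].
case: b s0 => /=; first by rewrite addNb addbN.
by case: x => [|x]; rewrite /step_prob ?subrr ?eqxx//= addNb addbN negbK.
Qed.

Lemma fiber_sum d (T : measurableType d) (R : realType) (P : probability T R)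
    (A : eqType) (l : seq A) (f : T -> A) (mu : A -> R) (F : pred A) :
  uniq l -> (forall u, f u \in l) -> (forall a, measurable [set u | f u = a]) ->
  (forall a, a \in l -> P [set u | f u = a] = (mu a)%:E) ->
  measurable [set u | F (f u)] /\
  P [set u | F (f u)] = (\sum_(a <- l | F a) mu a)%:E.
Proof.
move=> ul fl mf Pf.
have -> : [set u | F (f u)] = [set u | f u \in l /\ F (f u)].
  by apply/seteqP; split=> u /=; [move=> ?; split|case].
elim: l ul {fl} Pf => [|a l IH] /= => [_ _|/andP[al ul] Pf].
  rewrite big_nil (_ : [set u | _] = set0) ?measure0//.
  by apply/seteqP; split=> u //= -[].
have [|mI PI] := IH ul; first by move=> b bl; apply: Pf; rewrite inE bl orbT.
rewrite big_cons; case: ifPn => Fa.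
  have -> : [set u | f u \in a :: l /\ F (f u)] =
      [set u | f u = a] `|` [set u | f u \in l /\ F (f u)].
    apply/seteqP; split=> u /=; rewrite inE.
      by case=> /orP[/eqP|]; [left|right].
    by case=> [->|[-> ->]]; rewrite ?eqxx ?orbT.
  split; first exact: measurableU.
  rewrite measureU//; last first.
    apply/seteqP; split=> u //= -[-> []]; by rewrite (negbTE al).
  by rewrite EFinD; congr (_ + _)%E => //; apply: Pf; rewrite mem_head.
have -> : [set u | f u \in a :: l /\ F (f u)] = [set u | f u \in l /\ F (f u)].
  apply/seteqP; split=> u /=; rewrite inE.
    by case=> /orP[/eqP -> | //]; rewrite (negbTE Fa).
  by case=> [-> ->]; rewrite orbT.
by [].
Qed.

Section Marginal.
Context d (T : measurableType d) (R : realType) (P : probability T R).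
Variables (p : nat -> R) (m t : nat -> nat).
Variables (S1 S2 : nat -> T -> seq bool).
Variable J : nat -> nat -> nat -> seq bool -> seq bool -> R.
Variable mu : nat -> seq bool -> seq bool -> R.
Hypothesis t0 : t 0%N = 0%N.
Hypothesis tS : forall k, t k.+1 = (t k + m k)%N.
Hypothesis S1size : forall k u, size (S1 k u) = t k.
Hypothesis S2size : forall k u, size (S2 k u) = t k.
Hypothesis Smeas : forall k w y, measurable [set u | S1 k u = w /\ S2 k u = y].
Hypothesis muE : forall k w y, P [set u | S1 k u = w /\ S2 k u = y] = (mu k w y)%:E.
Hypothesis muS : forall k w y v z, size w = t k -> size y = t k ->
  size v = m k -> size z = m k ->
  mu k.+1 (w ++ v) (y ++ z) = mu k w y * J k (walk_pos 0 w) (walk_pos 0 y) v z.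
Hypothesis J_left : forall k x y v, v \in words (m k) ->
  \sum_(z <- words (m k)) J k x y v z = word_prob p x v.

Lemma marginal_law k w :
  measurable [set u | S1 k u = w] /\
  P [set u | S1 k u = w] = (\sum_(y <- words (t k)) mu k w y)%:E.
Proof.
have pE (a : seq bool * seq bool) : [set u | (S1 k u, S2 k u) = a] =
    [set u | S1 k u = a.1 /\ S2 k u = a.2].
  by apply/seteqP; split=> u; case: a => a b /= [-> ->].
have ul : uniq [seq (w, y) | w <- words (t k), y <- words (t k)].
  by apply: allpairs_uniq; rewrite ?uniq_words// => -[a b] [a' b'].
have := @fiber_sum _ T R P _ _ (fun u => (S1 k u, S2 k u)) (fun a => mu k a.1 a.2)
  (fun a => a.1 == w) ul.
case.
- by move=> u; apply: allpairs_f; rewrite mem_words ?S1size ?S2size.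
- by move=> a; rewrite pE.
- by move=> a _; rewrite pE.
have -> : [set u | (S1 k u, S2 k u).1 == w] = [set u | S1 k u = w].
  by apply/seteqP; split=> u /= /eqP.
move=> mS ->; split=> //; congr EFin.
rewrite big_mkcond big_allpairs /=.
have [wt|wt] := boolP (w \in words (t k)).
  rewrite (bigD1_seq w) ?uniq_words//= [X in _ + X]big1 ?addr0 => [|v /negbTE vw].
    by apply: eq_bigr => y _; rewrite eqxx.
  by rewrite big1// => y _; rewrite vw.
transitivity (0 : R).
  rewrite big1_seq// => v /andP[_ vt]; rewrite big1// => y _.
  by case: eqP => // vw; move: wt; rewrite -vw vt.
apply/esym; rewrite big1// => y _.
have : P [set u | S1 k u = w /\ S2 k u = y] = 0%E.
  rewrite (_ : [set u | _] = set0) ?measure0//; apply/seteqP; split=> u //=.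
  by move=> [E _]; move: wt; rewrite mem_words -E S1size eqxx.
by rewrite muE => -[].
Qed.

(** Summing the second word out of block k leaves the kernel of the p-walk from the position of the
    first word, whatever the second position is; this drives an induction on the blocks. *)
Lemma marginal_word_prob k w : size w = t k ->
  \sum_(y <- words (t k)) mu k w y = word_prob p 0 w.
Proof.
elim: k w => [|k IH] w.
  rewrite t0 => /size0nil ->; rewrite big_seq1 /=.
  have := muE 0 [::] [::]; rewrite (_ : [set u | _] = setT).
    by rewrite probability_setT => -[].
  by apply/seteqP; split=> u //= _; split; apply/size0nil; rewrite ?S1size ?S2size.
rewrite tS => sw; rewrite -(cat_take_drop (t k) w).
set a := take _ _; set b := drop _ _.
have sa : size a = t k by rewrite size_take sw; case: ltnP; lia.
have sb : size b = m k by rewrite size_drop sw; lia.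
rewrite big_words_add word_prob_cat -(IH _ sa) big_distrl /=.
rewrite big_seq [RHS]big_seq; apply: eq_bigr => y.
rewrite mem_words => /eqP sy.
rewrite -(@J_left k (walk_pos 0 a) (walk_pos 0 y)) ?mem_words ?sb// big_distrr /=.
rewrite big_seq [RHS]big_seq; apply: eq_bigr => z; rewrite mem_words => /eqP sz.
exact: muS.
Qed.

End Marginal.

Definition word_process d (T : measurableType d) (R : realType)
    (P : probability T R) (p : nat -> R) (w : nat -> T -> seq bool) : Prop :=
  [/\ forall n u, size (w n u) = n,
      forall n u, take n (w n.+1 u) = w n u,
      forall n v, measurable [set u | w n u = v] &
      forall n v, size v = n -> P [set u | w n u = v] = (word_prob p 0 v)%:E].

(** The word at level n has at least n letters, and the probabilities of the letters beyond the n-th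
    sum to 1. *)
Lemma word_process_prefix d (T : measurableType d) (R : realType)
    (P : probability T R) (p : nat -> R) (t : nat -> nat) (S : nat -> T -> seq bool) :
  half_params p ->
  (forall n, (n <= t n)%N) -> (forall k u, size (S k u) = t k) ->
  (forall k u, take (t k) (S k.+1 u) = S k u) -> {homo t : m n / (m <= n)%N} ->
  (forall k v, measurable [set u | S k u = v]) ->
  (forall k v, size v = t k -> P [set u | S k u = v] = (word_prob p 0 v)%:E) ->
  word_process P p (fun n u => take n (S n u)).
Proof.
move=> pp tn Ssz Stk tmono Sm SP.
have fib n v : measurable [set u | take n (S n u) = v] /\
    P [set u | take n (S n u) = v] = (\sum_(w <- words (t n) | take n w == v)
        word_prob p 0 w)%:E.
  have -> : [set u | take n (S n u) = v] = [set u | take n (S n u) == v].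
    by apply/seteqP; split=> u /= /eqP.
  apply: (fiber_sum (fun w => take n w == v) (uniq_words (t n))).
  - by move=> u; rewrite mem_words Ssz.
  - exact: Sm.
  - by move=> w; rewrite mem_words => /eqP/SP.
split.
- by move=> n u; rewrite size_takel// Ssz.
- move=> n u; rewrite take_takel// -(Stk n u) take_takel//.
- by move=> n v; case: (fib n v).
- move=> n v sv; rewrite (fib n v).2; congr EFin.
  rewrite -{1}(subnKC (tn n)) big_mkcond big_words_add.
  rewrite (bigD1_seq v) ?uniq_words ?mem_words ?sv//=.
  rewrite [X in _ + X]big_seq_cond [X in _ + X]big1 ?addr0 => [|w].
    rewrite -[RHS]mulr1 -(word_prob_sum1 p (t n - n) (walk_pos 0 v)) big_distrr /=.
    by apply: eq_bigr => z _; rewrite take_size_cat// eqxx word_prob_cat.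
  rewrite mem_words => /andP[/eqP sw /negbTE vw].
  by rewrite big1// => z _; rewrite take_size_cat// vw.
Qed.

(** * Block coupling of the two walks *)

(** Where the cut at 1/2 is active, p j <= 1/2 < B/(4j), so 1/2 is at least as close to B/(4j) as p
    j. *)
Lemma bessel_like_ref (R : realType) (B gamma C : R) p : 1 < B ->
  bessel_like B gamma C p ->
  bessel_like B gamma C (fun j => Num.min (B / (4 * j%:R)) 2^-1).
Proof.
move=> B1 [pp pB]; split=> j j1.
  rewrite le_min ge_min lexx orbT andbT invr_ge0 ler0n andbT.
  by rewrite divr_ge0 ?mulr_ge0 ?ler0n//; lra.
have := pB j j1; have := pp j j1; case: (leP (B / (4 * j%:R)) 2^-1) => h h1 h2.
  by rewrite subrr normr0; apply: le_trans h2.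
by apply: le_trans h2; rewrite ![`|_ - B / _|]ler0_norm; lra.
Qed.

Lemma ref_mono (R : realType) (B : R) i j : 1 < B -> (1 <= i)%N -> (i <= j)%N ->
  Num.min (B / (4 * j%:R)) 2^-1 <= Num.min (B / (4 * i%:R)) 2^-1 :> R.
Proof.
move=> B1 i1 ij; rewrite le_min !ge_min lexx orbT andbT; apply/orP; left.
rewrite ler_wpM2l//; first by lra.
by rewrite lef_pV2 ?posrE ?mulr_gt0 ?ltr0n ?ler_pM2l ?ler_nat//; lia.
Qed.

Lemma expect_law_dist (R : realType) (p q f : nat -> R) m n a b : half_params p ->
  (forall x, law_dist p q m x <= a * f x + b) ->
  \sum_(w <- words n) word_prob p 0 w * law_dist p q m (walk_pos 0 w) <= a * iter n
      (transition p) f 0%N + b.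
Proof.
move=> pp h; rewrite (word_prob_iter p n (law_dist p q m)).
apply: (@le_trans _ _ (iter n (transition p) (fun x => a * f x + b) 0%N)).
  exact: iter_transition_le.
by rewrite iter_transitionD iter_transitionZ iter_transition_cst.
Qed.

Section BlockProcess.
Variables (R : realType) (p1 p2 : nat -> R) (m : nat -> nat).
Variable eps1 eps2 : nat -> nat -> R.
Variable J : nat -> nat -> nat -> seq bool -> seq bool -> R.
Hypothesis J0 : forall k x y w v, 0 <= J k x y w v.
Hypothesis Jl : forall k x y w, w \in words (m k) ->
  \sum_(v <- words (m k)) J k x y w v = word_prob p1 x w.
Hypothesis Jr : forall k x y v, v \in words (m k) ->
  \sum_(w <- words (m k)) J k x y w v = word_prob p2 y v.
Hypothesis Jb : forall k x y, odd x = odd y ->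
  \sum_(w <- words (m k)) \sum_(v <- words (m k) | ~~ stay_close (gap x y) x y w v)
    J k x y w v <= eps1 k x + eps2 k y.

Definition block_time (k : nat) : nat := \sum_(i < k) m i.

Lemma block_timeS k : block_time k.+1 = (block_time k + m k)%N.
Proof. by rewrite /block_time big_ord_recr. Qed.

(* The states of the underlying tree at level k are the pairs of increment words
   up to time block_time k; the event F is the failure of block k. *)
Lemma block_process : exists (d : measure_display) (T : measurableType d)
    (P : probability T R) (S1 S2 : nat -> T -> seq bool),
  [/\ [/\ forall k u, size (S1 k u) = block_time k,
          forall k u, take (block_time k) (S1 k.+1 u) = S1 k u,
          forall k v, measurable [set u | S1 k u = v] &
          forall k v, size v = block_time k -> P [set u | S1 k u = v] = (word_prob p1
              0 v)%:E],
      [/\ forall k u, size (S2 k u) = block_time k,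
          forall k u, take (block_time k) (S2 k.+1 u) = S2 k u,
          forall k v, measurable [set u | S2 k u = v] &
          forall k v, size v = block_time k -> P [set u | S2 k u = v] = (word_prob p2
              0 v)%:E] &
      forall k, let F := [set u | let x := walk_pos 0 (S1 k u) in let y
          := walk_pos 0 (S2 k u) in
          ~~ stay_close (gap x y) x y (drop (block_time k) (S1 k.+1 u)) (drop
              (block_time k) (S2 k.+1 u))] in
        measurable F /\
        (P F <= (\sum_(w <- words (block_time k)) word_prob p1 0 w * eps1 k (walk_pos
            0 w) +
                \sum_(w <- words (block_time k)) word_prob p2 0 w * eps2 k (walk_pos
                    0 w))%:E)%E ].
Proof.
pose N := (seq bool * seq bool)%type.
pose ch k (s : N) : seq N :=
  [seq (s.1 ++ w, s.2 ++ v) | w <- words (m k), v <- words (m k)].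
pose wt k (s s' : N) := J k (walk_pos 0 s.1) (walk_pos 0 s.2)
  (drop (size s.1) s'.1) (drop (size s.2) s'.2).
pose par k (s : N) : N :=
  (take (size s.1 - m k) s.1, take (size s.2 - m k) s.2).
have chU k s : uniq (ch k s).
  apply: allpairs_uniq; rewrite ?uniq_words// => -[a b] [a' b'] _ _ /= [].
  by move=> /eqP + /eqP; rewrite !eqseq_cat// !eqxx /= => /eqP -> /eqP ->.
have chP k (s s' : N) : s' \in ch k s -> par k s' = s.
  move=> /allpairsP[[w v] /= [wm vm ->]]; rewrite /par /=.
  move: wm vm; rewrite !mem_words => /eqP <- /eqP vw.
  rewrite !size_cat addnK take_size_cat// -vw addnK take_size_cat//.
  by case: s.
have wt0 k s s' : 0 <= wt k s s' by exact: J0.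
have wt1 k s : \sum_(s' <- ch k s) wt k s s' = 1.
  rewrite /ch big_allpairs_dep /wt /=.
  transitivity (\sum_(w <- words (m k)) word_prob p1 (walk_pos 0 s.1) w);
      last exact: word_prob_sum1.
  rewrite big_seq [RHS]big_seq; apply: eq_bigr => w wm.
  rewrite -(Jl (walk_pos 0 s.1) (walk_pos 0 s.2) wm).
  by apply: eq_bigr => v _; rewrite !drop_size_cat.
have [d [T [P [S [S0 Sch Sm SP]]]]] := tree_space ([::], [::]) chU chP wt0 wt1.
have SchE k u : exists w v, [/\ size w = m k, size v = m k &
    S k.+1 u = ((S k u).1 ++ w, (S k u).2 ++ v)].
  have /allpairsP[[w v] /= [wm vm ->]] := Sch k u.
  by exists w, v; move: wm vm; rewrite !mem_words => /eqP -> /eqP ->.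
have Ssize k u : size (S k u).1 = block_time k /\ size (S k u).2 = block_time k.
  elim: k => [|k [IH1 IH2]]; first by rewrite S0 /block_time big_ord0.
  have [w [v [sw sv ->]]] := SchE k u.
  by rewrite !size_cat IH1 IH2 sw sv block_timeS.
have S1size k u : size (S k u).1 = block_time k by case: (Ssize k u).
have S2size k u : size (S k u).2 = block_time k by case: (Ssize k u).
have SE k w y : [set u | (S k u).1 = w /\ (S k u).2 = y] = [set u | S k u = (w, y)].
  by apply/seteqP; split=> u /=; case: (S k u) => a b /= [-> ->].
pose mu k w y := fine (P [set u | S k u = (w, y)]).
have muE k w y : P [set u | S k u = (w, y)] = (mu k w y)%:E.
  by rewrite /mu fineK// fin_num_measure.
have mu0 k w y : 0 <= mu k w y by rewrite /mu fine_ge0.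
have muS k w y v z : size w = block_time k -> size y = block_time k ->
    size v = m k -> size z = m k ->
    mu k.+1 (w ++ v) (y ++ z) = mu k w y * J k (walk_pos 0 w) (walk_pos 0 y) v z.
  move=> sw sy sv sz; have := @SP k (w, y) (w ++ v, y ++ z).
  rewrite !muE -EFinM /wt /= !drop_size_cat// => h.
  suff [] : (mu k.+1 (w ++ v) (y ++ z))%:E = (mu k w y * J k (walk_pos 0 w) (walk_pos
      0 y) v z)%:E by [].
  by apply: h; apply/allpairsP; exists (v, z); rewrite !mem_words sv sz !eqxx.
have bt0 : block_time 0 = 0%N by rewrite /block_time big_ord0.
pose S1 k u := (S k u).1; pose S2 k u := (S k u).2.
have mS k w y : measurable [set u | S1 k u = w /\ S2 k u = y] by rewrite SE.
have mS' k w y : measurable [set u | S2 k u = w /\ S1 k u = y].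
  by rewrite (_ : [set u | _] = [set u | S1 k u = y /\ S2 k u = w])//;
    apply/seteqP; split=> u /= [].
have PS k w y : P [set u | S1 k u = w /\ S2 k u = y] = (mu k w y)%:E by rewrite SE muE.
have PS' k w y : P [set u | S2 k u = w /\ S1 k u = y] = (mu k y w)%:E.
  by rewrite (_ : [set u | _] = [set u | S1 k u = y /\ S2 k u = w])//;
    apply/seteqP; split=> u /= [].
have law1 k w := marginal_law S1size S2size mS PS k w.
have law2 k w := marginal_law S2size S1size mS' PS' k w.
have Q1 k w (sw : size w = block_time k) := marginal_word_prob bt0 block_timeS S1size
    S2size PS muS Jl sw.
have muS' k w y v z : size w = block_time k -> size y = block_time k ->
    size v = m k -> size z = m k ->
    mu k.+1 (y ++ z) (w ++ v) = mu k y w * J k (walk_pos 0 y) (walk_pos 0 w) z v.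
  by move=> *; apply: muS.
have Q2 k w (sw : size w = block_time k) :=
  @marginal_word_prob _ _ _ P p2 m block_time S2 S1 (fun k x y v z =>
      J k y x z v) (fun k w y => mu k y w)
   bt0 block_timeS S2size S1size PS' muS' (fun k x y v => @Jr k y x v) k w sw.
exists d, T, P, S1, S2; split.
- split=> // [k u|k v|k v sv]; [|exact: (law1 k v).1|by rewrite (law1 k v).2 Q1].
  by have [w [v [_ _ E]]] := SchE k u; rewrite /S1 E /= take_size_cat.
- split=> // [k u|k v|k v sv]; [|exact: (law2 k v).1|by rewrite (law2 k v).2 Q2].
  by have [w [v [_ _ E]]] := SchE k u; rewrite /S2 E /= take_size_cat.
- move=> k F.
  pose bad (s : N) := let x := walk_pos 0 (take (block_time k) s.1) in
    let y := walk_pos 0 (take (block_time k) s.2) in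
    ~~ stay_close (gap x y) x y (drop (block_time k) s.1) (drop (block_time k) s.2).
  have FE : F = [set u | bad (S k.+1 u)].
    rewrite /F /bad /S1 /S2; apply/seteqP; split=> u /=;
      by have [w [v [_ _ ->]]] := SchE k u; rewrite /= !take_size_cat.
  have ul : uniq [seq (w, y) | w <- words (block_time k.+1),
      y <- words (block_time k.+1)].
    by apply: allpairs_uniq; rewrite ?uniq_words// => -[a b] [a' b'].
  have := fiber_sum bad ul (f := S k.+1) (mu := fun a => mu k.+1 a.1 a.2) (P := P).
  case.
  + by move=> u; rewrite [S k.+1 u]surjective_pairing; apply: allpairs_f;
      rewrite mem_words ?S1size ?S2size.
  + exact: Sm.
  + by move=> [a b] _; rewrite muE.
  rewrite -FE => mF ->; split=> //; rewrite lee_fin.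
  rewrite big_mkcond big_allpairs /= block_timeS big_words_add.
  rewrite [leLHS](_ : _ = \sum_(w <- words (block_time k)) \sum_(y <- words
      (block_time k))
      mu k w y * \sum_(v <- words (m k)) \sum_(z <- words (m k) |
        ~~ stay_close (gap (walk_pos 0 w) (walk_pos 0 y)) (walk_pos 0 w) (walk_pos 0
            y) v z)
        J k (walk_pos 0 w) (walk_pos 0 y) v z); last first.
    rewrite big_seq [RHS]big_seq; apply: eq_bigr => w; rewrite mem_words => /eqP sw.
    under eq_bigr do rewrite big_words_add.
    rewrite exchange_big /= big_seq [RHS]big_seq; apply: eq_bigr => y.
    rewrite mem_words => /eqP sy; rewrite big_distrr /= big_seq [RHS]big_seq.
    apply: eq_bigr => v; rewrite mem_words => /eqP sv.
    rewrite big_distrr /= [RHS]big_mkcond big_seq [RHS]big_seq.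
    apply: eq_bigr => z; rewrite mem_words => /eqP sz.
    by rewrite /bad /= !take_size_cat// !drop_size_cat// muS//.
  apply: (@le_trans _ _ (\sum_(w <- words (block_time k)) \sum_(y <- words
      (block_time k))
      mu k w y * (eps1 k (walk_pos 0 w) + eps2 k (walk_pos 0 y)))).
    rewrite big_seq [leRHS]big_seq; apply: ler_sum => w; rewrite mem_words => /eqP sw.
    rewrite big_seq [leRHS]big_seq; apply: ler_sum => y; rewrite mem_words => /eqP sy.
    have [->|N0] := eqVneq (mu k w y) 0; first by rewrite !mul0r.
    apply: ler_wpM2l => //; apply: Jb.
    (* A pair of positive mass has both words of positive probability and equal length, hence end
       points of equal parity, as [Jb] requires. *)
    have /word_prob_odd -> : word_prob p1 0 w != 0.
      apply: contra N0 => /eqP; rewrite -(Q1 k w sw) => /eqP.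
      rewrite psumr_eq0// => /allP/(_ y); rewrite mem_words sy eqxx.
      by move=> /(_ isT).
    have /word_prob_odd -> : word_prob p2 0 y != 0.
      apply: contra N0 => /eqP; rewrite -(Q2 k y sy) => /eqP.
      rewrite psumr_eq0// => /allP/(_ w); rewrite mem_words sw eqxx.
      by move=> /(_ isT).
    by rewrite sw sy.
  apply: (@le_trans _ _
      (\sum_(w <- words (block_time k)) \sum_(y <- words (block_time k)) mu k w y *
          eps1 k (walk_pos 0 w)
     + \sum_(y <- words (block_time k)) \sum_(w <- words (block_time k)) mu k w y *
         eps2 k (walk_pos 0 y))).
    rewrite [X in _ + X]exchange_big -big_split; apply: ler_sum => w _.
    by rewrite -big_split; apply: ler_sum => y _; rewrite mulrDr.
  rewrite lerD// big_seq [leRHS]big_seq; apply: ler_sum => w; rewrite mem_words =>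
      /eqP sw.
    by rewrite -big_distrl /= Q1.
  by rewrite -big_distrl /= Q2.
Qed.

End BlockProcess.

Lemma coupled_words (R : realType) (B gamma C : R) (p1 p2 : nat -> R) :
  1 < B -> 1 < gamma -> gamma <= 2 -> 0 <= C ->
  bessel_like B gamma C p1 -> bessel_like B gamma C p2 ->
  exists (d : measure_display) (T : measurableType d) (P : probability T R)
    (w1 w2 : nat -> T -> seq bool) (t : nat -> nat) (F : nat -> set T) (c : R),
  [/\ word_process P p1 w1, word_process P p2 w2,
      t 0%N = 0%N /\ (forall k, (t k < t k.+1)%N),
      forall k, measurable (F k) /\ (P (F k) <= (c * 2^-1 ^+ k)%:E)%E &
      forall k u n, ~ F k u -> (t k <= n <= t k.+1)%N ->
        (gap (walk_pos 0 (w1 n u)) (walk_pos 0 (w2 n u)) <=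
         gap (walk_pos 0 (w1 (t k) u)) (walk_pos 0 (w2 (t k) u)))%N].
Proof.
move=> B1 g1 g2 C0 N1 N2.
pose dl := (B - 1) / 2.
have dl0 : 0 < dl by rewrite /dl; lra.
(* The three upper bounds required by [law_dist_bound]; the last is positive because gamma > 1. *)
pose th := Num.min (Num.min 2^-1 (dl / 40)) (2 * gamma - 2).
have th0 : 0 < th by rewrite !lt_min; apply/andP; split; [apply/andP; split|]; lra.
have th2 : th <= 2^-1 by rewrite !ge_min lexx.
have thd : th <= dl / 40 by rewrite !ge_min lexx orbT.
have thg : th <= 2 * gamma - 2 by rewrite !ge_min lexx orbT.
have [K K0 KP] := law_dist_bound B1 g1 g2 C0 erefl th0 th2 thd thg.
pose p0 : nat -> R := fun j => Num.min (B / (4 * j%:R)) 2^-1.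
have N0 : bessel_like B gamma C p0 := bessel_like_ref B1 N1.
pose E p n := iter n (transition p) (lyap th) 0%N.
have tr p : bessel_like B gamma C p -> forall k, exists n0 : nat,
    forall n, (n0 <= n)%N -> E p n <= 4^-1 ^+ k.
  move=> pN k; have := transience B1 g1 C0 erefl th0 th2 thd pN.
  have e0 : 0 < (4^-1 : R) ^+ k by rewrite exprn_gt0.
  move=> /cvgrPdist_le/(_ _ e0) [n0 _ n0P]; exists n0 => n nn0.
  by have := n0P n nn0; rewrite sub0r normrN; apply: le_trans; exact: ler_norm.
have [n1 n1P] := choice (tr _ N1).
have [n2 n2P] := choice (tr _ N2).
(* At the end of block k the expectation of [lyap] is at most 4^-(k+1) for both walks; the successor
   keeps blocks nonempty. *)
pose m k := (maxn (n1 k.+1) (n2 k.+1)).+1.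
pose J0 (z : nat * nat * nat) := block_coupling (m z.1.1) z.1.2 z.2
  N0.1 N1.1 N2.1 (fun i j => @ref_mono R B i j B1).
have [J JP] := choice J0.
have [d [T [P [S1 [S2 [[sz1 tk1 m1 P1] [sz2 tk2 m2 P2] bad]]]]]] :=
  @block_process R p1 p2 m (fun k => law_dist p1 p0 (m k)) (fun k =>
      law_dist p2 p0 (m k))
    (fun k x y => J (k, x, y))
    (fun k x y => let: And4 h _ _ _ := JP (k, x, y) in h)
    (fun k x y => let: And4 _ h _ _ := JP (k, x, y) in h)
    (fun k x y => let: And4 _ _ h _ := JP (k, x, y) in h)
    (fun k x y => let: And4 _ _ _ h := JP (k, x, y) in h).
have t0 : block_time m 0 = 0%N by rewrite /block_time big_ord0.
have tS k : block_time m k.+1 = (block_time m k + m k)%N := block_timeS m k.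
have tlt k : (block_time m k < block_time m k.+1)%N by rewrite tS /m; lia.
have tn n : (n <= block_time m n)%N.
  by elim: n => // n IH; apply: leq_ltn_trans IH (tlt n).
have tmono : {homo block_time m : i j / (i <= j)%N}.
  by apply: homo_leq => // [i|i]; [exact: leq_trans|exact/ltnW].
pose F k := [set u | let x := walk_pos 0 (S1 k u) in let y := walk_pos 0 (S2 k u) in
          ~~ stay_close (gap x y) x y (drop (block_time m k) (S1 k.+1 u))
            (drop (block_time m k) (S2 k.+1 u))].
exists d, T, P, (fun n u => take n (S1 n u)), (fun n u => take n (S2 n u)),
    (block_time m), F,
  (2 * (K + 2)).
have Ebnd p n0 k : bessel_like B gamma C p ->
    (forall k n, (n0 k <= n)%N -> E p n <= 4^-1 ^+ k) ->
    (forall k, (n0 k.+1 <= m k)%N) ->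
    \sum_(w <- words (block_time m k)) word_prob p 0 w * law_dist p p0 (m k)
        (walk_pos 0 w) <=
    (K + 2) * 2^-1 ^+ k.
  move=> pN n0P n0m; have t2 : 0 < (2^-1 : R) ^+ k by rewrite exprn_gt0.
  have Ek : E p (block_time m k) <= 4^-1 ^+ k.
    (* Block 0 starts at time 0 from position 0, where [lyap] is 1. *)
    case: k {t2} => [|k]; last first.
      by apply: n0P; apply: leq_trans (n0m k) _; rewrite tS leq_addl.
    by rewrite t0 /E /= /lyap powR1 expr0.
  (* The free weight is t = 2^-k: then K 4^-k / t and 2 t are both of order 2^-k. *)
  apply: le_trans (expect_law_dist (f := lyap th) (a := K / 2^-1 ^+ k) (b
      := 2 * 2^-1 ^+ k) _ pN.1 _) _.
    by move=> x; rewrite mulrAC; apply: KP.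
  rewrite [leRHS]mulrDl lerD2r -/(E p _); apply: le_trans (ler_wpM2l _ Ek) _.
    by rewrite divr_ge0// ltW.
  rewrite (_ : 4^-1 = 2^-1 * 2^-1); last by lra.
  by rewrite exprMn mulrA divfK// gt_eqF.
split.
- exact: word_process_prefix N1.1 tn sz1 tk1 tmono m1 P1.
- exact: word_process_prefix N2.1 tn sz2 tk2 tmono m2 P2.
- by [].
- move=> k; have [mF PF] := bad k; split=> //.
  apply: le_trans PF _; rewrite lee_fin -mulrA mulr_natl mulr2n; apply: lerD.
    by apply: (Ebnd _ _ _ N1 n1P) => j; rewrite /m ltnW// ltnS leq_maxl.
  by apply: (Ebnd _ _ _ N2 n2P) => j; rewrite /m ltnW// ltnS leq_maxr.
- move=> k u n /negP; rewrite negbK => nF /andP[tkn ntk].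
  have tkl (S : nat -> T -> seq bool) :
      (forall k u, take (block_time m k) (S k.+1 u) = S k u) ->
      forall a j, take (block_time m a) (S (a + j)%N u) = S a u.
    move=> h a; elim=> [|j IH].
      rewrite addn0 -[RHS]h -[S a u]h take_takel//.
    by rewrite -[RHS]IH -[S (a + j)%N u]h take_takel ?addnS// tmono// leq_addr.
  have pref (S : nat -> T -> seq bool) :
      (forall k u, take (block_time m k) (S k.+1 u) = S k u) ->
      forall a b i, (i <= block_time m a)%N -> (i <= block_time m b)%N ->
      take i (S a u) = take i (S b u).
    move=> h a b i ia ib; case: (leqP a b) => [|/ltnW] ab.
      by rewrite -(tkl S h a (b - a)%N) subnKC// take_takel.
    by rewrite -(tkl S h b (a - b)%N) subnKC// take_takel.
  rewrite !(pref S1 tk1 _ k.+1)//; last exact/ltnW.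
  rewrite !(pref S2 tk2 _ k.+1)//; last exact/ltnW.
  rewrite tk1 tk2 -(subnKC tkn) !takeD tk1 tk2 !walk_pos_cat.
  apply: stay_close_take nF.
  by rewrite !size_drop sz1 sz2.
Qed.

(** * From words to walks *)

Section WordWalk.
Context d (T : measurableType d) (R : realType) (P : probability T R).
Variables (p : nat -> R) (w : nat -> T -> seq bool).
Hypothesis pp : half_params p.
Hypothesis wP : word_process P p w.

Lemma word_process_take k n u : (k <= n)%N -> take k (w n u) = w k u.
Proof.
have [wsz wtk _ _] := wP; move=> kn; rewrite -(subnKC kn).
elim: (n - k)%N => [|j IH]; first by rewrite addn0 take_oversize// wsz.
by rewrite -IH -[w (k + j)%N u]wtk take_takel ?addnS// leq_addr.
Qed.

Lemma word_process_event n (F : pred (seq bool)) :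
  measurable [set u | F (w n u)] /\
  P [set u | F (w n u)] = (\sum_(v <- words n | F v) word_prob p 0 v)%:E.
Proof.
have [wsz _ wm wQ] := wP; apply: (fiber_sum F (uniq_words n)).
- by move=> u; rewrite mem_words wsz.
- exact: wm.
- by move=> v; rewrite mem_words => /eqP/wQ.
Qed.

Lemma word_process_rv : exists X : nat -> {RV P >-> nat},
  forall n u, X n u = walk_pos 0 (w n u).
Proof.
have mX n : measurable_fun setT (fun u => walk_pos 0 (w n u)).
  move=> _ Y _; rewrite setTI.
  have [mF _] := word_process_event n (fun v => `[< Y (walk_pos 0 v) >]).
  rewrite (_ : _ @^-1` _ = [set u | `[< Y (walk_pos 0 (w n u)) >]])//.
  by apply/seteqP; split=> u /= /asboolP.
by exists (fun n => mfun_Sub (mem_set (mX n))).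
Qed.

Variable X : nat -> {RV P >-> nat}.
Hypothesis XE : forall n u, X n u = walk_pos 0 (w n u).

Let tr (i j : nat) : R :=
  step_prob p i true * (i.+1 == j)%:R + step_prob p i false * (i.-1 == j)%:R.

Let joint_step n (F : pred (seq bool)) i j : (forall v, F v -> walk_pos 0 v = i) ->
  P ([set u | X n.+1 u = j] `&` [set u | F (w n u)]) =
  ((\sum_(v <- words n | F v) word_prob p 0 v) * tr i j)%:E.
Proof.
move=> Fi; have [_ wtk _ _] := wP.
have -> : [set u | X n.+1 u = j] `&` [set u | F (w n u)] =
   [set u | F (take n (w n.+1 u)) && (walk_pos 0 (w n.+1 u) == j)].
  apply/seteqP; split=> u /=; rewrite XE wtk.
    by case=> -> ->; rewrite eqxx.
  by case/andP => -> /eqP.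
rewrite (word_process_event n.+1 (fun v => F (take n v) && (walk_pos 0 v == j))).2.
congr EFin; rewrite big_mkcond -addn1 big_words_add big_distrl [RHS]big_mkcond.
rewrite big_seq [RHS]big_seq; apply: eq_bigr => v; rewrite mem_words => /eqP sv.
rewrite big_cons big_seq1 !take_size_cat// !walk_pos_cat.
case Fv: (F v); last by rewrite /= addr0.
rewrite !word_prob_cat /= (Fi _ Fv) /tr.
by case: eqP => _; case: eqP => _ /=; ring.
Qed.

(** Covers conditioning on the past and on the present alike: both are events of the word that fix
    the position, so both give the same value, which is the Markov property. *)
Let cond n (F : pred (seq bool)) i j : (forall v, F v -> walk_pos 0 v = i) ->
  P [set u | F (w n u)] != 0%E ->
  cond_prob P [set u | X n.+1 u = j] [set u | F (w n u)] = tr i j.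
Proof.
move=> Fi; rewrite /cond_prob (joint_step _ _ Fi) (word_process_event n F).2 /= => N0.
by rewrite [_ * tr _ _]mulrC mulfK//; apply: contra N0 => /eqP ->.
Qed.

Lemma word_process_walk : nn_walk p X.
Proof.
have [wsz _ _ _] := wP.
have X1 n i : [set u | X n u = i] = [set u | walk_pos 0 (w n u) == i].
  by apply/seteqP; split=> u /=; rewrite XE => /eqP.
have c1 n i j : P [set u | X n u = i] != 0%E ->
    cond_prob P [set u | X n.+1 u = j] [set u | X n u = i] = tr i j.
  by rewrite X1; apply: (cond (F := fun v => walk_pos 0 v == i)) => v /eqP.
split.
- by move=> u; rewrite XE (size0nil (wsz 0%N u)).
- move=> n x j past Pp.
  pose F (v : seq bool) := (size v == n) &&
    all (fun k => walk_pos 0 (take k v) == x k) (iota 0 n.+1).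
  have pastE : past = [set u | F (w n u)].
    apply/seteqP; split=> u; rewrite /past /F /= wsz eqxx andTb => h.
      apply/(@allP _ (fun k => walk_pos 0 (take k (w n u)) == x k) (iota 0 n.+1)).
      move=> k; rewrite mem_iota => /andP[_ kn].
      by rewrite word_process_take// -XE; apply/eqP/h.
    move=> k kn; have /(_ k) := allP (h : all _ (iota 0 n.+1)).
    by rewrite mem_iota => /(_ kn)/eqP; rewrite word_process_take// -XE.
  have Fx v : F v -> walk_pos 0 v = x n.
    case/andP => /eqP sv /allP/(_ n); rewrite mem_iota => /(_ (ltnSn n))/eqP h.
    by rewrite -h take_oversize// sv.
  have Pn : P [set u | X n u = x n] != 0%E.
    apply: contra Pp => /eqP P0.
    rewrite eq_le measure_ge0 andbT -P0; apply: le_measure; rewrite ?inE.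
    - by rewrite pastE; case: (word_process_event n F).
    - by rewrite X1; case: (word_process_event n (fun v => walk_pos 0 v == x n)).
    - by move=> u; apply.
  rewrite c1// pastE; apply: (cond (F := F)) => //.
  by rewrite -pastE.
- move=> n i Pi; split.
    rewrite c1// /tr eqxx mulr1 (_ : (i.-1 == i.+1) = false) ?mulr0 ?addr0//.
    by apply/eqP; lia.
  (* At 0 the down-step event is empty, which matches [up_prob p 0 = 1]. *)
  case: i Pi => [|i] Pi.
    rewrite /cond_prob (_ : [set u | (X n.+1 u).+1 = 0%N] = set0); last first.
      by apply/seteqP; split.
    by rewrite set0I measure0 /= mul0r subr0.
  have -> : [set u | (X n.+1 u).+1 = i.+1] = [set u | X n.+1 u = i].
    by apply/seteqP; split=> u /= => [[]|->].
  rewrite c1// /tr /= eqxx mulr1 (_ : (i.+2 == i) = false) ?mulr0 ?add0r.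
    by rewrite /step_prob; ring.
  by apply/eqP; lia.
Qed.

End WordWalk.

(** * Upper bound of the law of the iterated logarithm *)

(** The first Borel-Cantelli lemma, with summability given by bounded partial sums. *)
Lemma ae_eventually d (T : measurableType d) (R : realType) (P : probability T R)
    (F : nat -> set T) (r : nat -> R) (M : R) :
  (forall k, measurable (F k)) -> (forall k, (P (F k) <= (r k)%:E)%E) ->
  (forall n, \sum_(k < n) r k <= M) ->
  {ae P, forall u, exists K, forall k, (K <= k)%N -> ~ F k u}.
Proof.
move=> mF PF rM; exists (lim_sup_set F); split.
- by apply: bigcapT_measurable => k; apply: bigcup_measurable.
- apply: lim_sup_set_cvg0 => //; apply: (@le_lt_trans _ _ M%:E); last exact: ltry.
  apply: lime_le; first exact: is_cvg_nneseries.
  apply: nearW => n; rewrite big_mkord.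
  apply: (@le_trans _ _ (\sum_(k < n) (r k)%:E)%E); first by apply: lee_sum => k _;
      exact: PF.
  by rewrite sumEFin lee_fin.
- move=> u /= nu k _; apply: contrapT => h; apply: nu; exists k => j kj Fj.
  by apply: h; exists j.
Qed.

Section UpperLIL.
Variables (R : realType) (p : nat -> R) (c : R).
Hypothesis pp : half_params p.
Hypothesis c0 : 0 <= c.
Hypothesis pc : forall x, (1 <= x)%N -> p x * x%:R <= c.

Definition twocosh (l : R) (x : nat) : R := expR (l * x%:R) + expR (- (l * x%:R)).

(** The symmetric part of the step contributes the factor cosh l <= 1 + 2 l^2. In the drift part,
    e^y - e^(-y) <= 2 y (e^y + e^(-y)) with y = l x gains a factor x, which p x <= c/x cancels. *)
Lemma twocosh_step (l : R) x : 0 <= l <= 1 ->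
  transition p (twocosh l) x <= expR ((2 + 8 * c) * l ^+ 2) * twocosh l x.
Proof.
move=> /andP[l0 l1].
have e1 := expR_le_quad l1.
have e2 : expR (- l) <= 1 - l + 2 * l ^+ 2.
  by have := @expR_le_quad R (- l); rewrite sqrrN; apply; lra.
have e3 := expR_ge1Dx (- l).
have l2 : 0 <= l ^+ 2 := sqr_ge0 l.
have ll : l ^+ 2 <= l by rewrite expr2 ler_piMl.
have g0 : 0 <= twocosh l x by rewrite addr_ge0 ?expR_ge0.
apply: (@le_trans _ _ ((1 + (2 + 8 * c) * l ^+ 2) * twocosh l x)); last first.
  by apply: ler_wpM2r => //; exact: expR_ge1Dx.
have cl : 0 <= c * l ^+ 2 by rewrite mulr_ge0.
case: x g0 => [|x] g0.
  rewrite /transition /step_prob /up_prob /= /twocosh mulr0 oppr0 expR0 mulr1; lra.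
have Ep : twocosh l x.+2 = expR l * expR (l * x.+1%:R) + expR (- l) * expR (- (l *
    x.+1%:R)).
  by rewrite /twocosh -!expRD -[x.+2%:R]natr1; congr (expR _ + expR _); ring.
have Em : twocosh l x = expR (- l) * expR (l * x.+1%:R) + expR l * expR (- (l *
    x.+1%:R)).
  by rewrite /twocosh -!expRD -[x.+1%:R]natr1; congr (expR _ + expR _); ring.
rewrite /transition /step_prob /up_prob /= Ep Em.
have pcx := pc (ltn0Sn x); have /andP[px0 _] := pp (ltn0Sn x).
have e4 : expR (l * x.+1%:R) - expR (- (l * x.+1%:R)) <= 2 * (l * x.+1%:R) * twocosh
    l x.+1.
  have y0 : 0 <= l * x.+1%:R by rewrite mulr_ge0.
  rewrite /twocosh; move: (l * x.+1%:R) y0 => y y0.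
  have h1 := expR_ge1Dx (- (2 * y)).
  have h2 : expR (- y) = expR y * expR (- (2 * y)) by rewrite -expRD; congr expR; ring.
  have h3 := ler_wpM2l (expR_ge0 y) h1.
  have h4 : 0 <= y * expR (- y) by rewrite mulr_ge0// expR_ge0.
  by lra.
have e5 : 0 <= expR (l * x.+1%:R) - expR (- (l * x.+1%:R)).
  by rewrite subr_ge0 ler_expR; have : 0 <= l * x.+1%:R by [rewrite mulr_ge0]; lra.
have e6 : 0 <= expR l - expR (- l) <= 4 * l.
  by rewrite subr_ge0 ler_expR; apply/andP; split; lra.
have e7 : p x.+1 * ((expR l - expR (- l)) * (expR (l * x.+1%:R) - expR (- (l *
    x.+1%:R))))
    <= 8 * c * l ^+ 2 * twocosh l x.+1.
  have /andP[e60 e61] := e6.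
  apply: (@le_trans _ _ (p x.+1 * (4 * l * (2 * (l * x.+1%:R) * twocosh l x.+1)))).
    by apply: ler_wpM2l => //; apply: ler_pM.
  have -> : p x.+1 * (4 * l * (2 * (l * x.+1%:R) * twocosh l x.+1)) =
     (p x.+1 * x.+1%:R) * (8 * l ^+ 2 * twocosh l x.+1) by ring.
  have -> : 8 * c * l ^+ 2 * twocosh l x.+1 = c * (8 * l ^+ 2 * twocosh l x.+1) by ring.
  by apply: ler_wpM2r => //; rewrite mulr_ge0// mulr_ge0.
have e8 : (expR l + expR (- l)) / 2 * twocosh l x.+1 <= (1 + 2 * l ^+ 2) * twocosh l
    x.+1.
  by apply: ler_wpM2r => //; lra.
move: e7 e8; rewrite /twocosh.
move: (expR (l * x.+1%:R)) (expR (- (l * x.+1%:R))) (expR l) (expR (- l)) (p x.+1).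
move=> y z a b q; lra.
Qed.

Fixpoint hits (a : R) (x : nat) (w : seq bool) : bool :=
  (a <= x%:R) || (if w is b :: w' then hits a (walk_step x b) w' else false).

Lemma not_hits_take a x w i : ~~ hits a x w -> (walk_pos x (take i w))%:R < a.
Proof.
elim: w x i => [|b w IH] x [|i] //=; rewrite negb_or -ltNge => /andP[h h'] //.
exact: IH.
Qed.

(* Induction on the first step, in place of optional stopping for the
   supermartingale twocosh l X_n * expR (- (2 + 8 c) l^2 n). *)
Lemma hits_bound (a l : R) x m : 0 <= l <= 1 ->
  (\sum_(w <- words m | hits a x w) word_prob p x w) * expR (l * a) <=
  twocosh l x * expR ((2 + 8 * c) * l ^+ 2 * m%:R).
Proof.
move=> l01; have /andP[l0 _] := l01.
have K0 : 0 <= (2 + 8 * c) * l ^+ 2 by rewrite mulr_ge0 ?sqr_ge0// addr_ge0// mulr_ge0.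
have big n y : a <= y%:R -> (\sum_(w <- words n | hits a y w) word_prob p y w) * expR
    (l * a) <=
  twocosh l y * expR ((2 + 8 * c) * l ^+ 2 * n%:R).
  move=> ay; apply: (@le_trans _ _ (1 * expR (l * y%:R))).
    apply: ler_pM; rewrite ?expR_ge0//.
    - by apply: sumr_ge0 => w _; apply: word_prob_ge0.
    - rewrite -(word_prob_sum1 p n y) [leRHS](bigID (hits a y)) /= lerDl.
      by apply: sumr_ge0 => w _; apply: word_prob_ge0.
    - by rewrite ler_expR ler_wpM2l.
  rewrite mul1r -[leLHS]mulr1; apply: ler_pM; rewrite ?expR_ge0//.
    by rewrite /twocosh lerDl expR_ge0.
  by apply: le_trans (expR_ge1Dx _); rewrite lerDl mulr_ge0.
elim: m x => [|m IH] x; have [ax|ax] := leP a x%:R; try exact: big;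
    have axF : (a <= x%:R) = false by [rewrite leNgt ax].
  rewrite big_cons big_nil /= axF /= mul0r.
  by rewrite mulr_ge0 ?expR_ge0// addr_ge0// expR_ge0.
rewrite big_mkcond big_wordsS /= axF /=.
have -> : (\sum_(w <- words m) (if hits a x.+1 w then step_prob p x true * word_prob
    p x.+1 w else 0)
   + \sum_(w <- words m) (if hits a x.-1 w then step_prob p x false * word_prob p
       x.-1 w else 0))
   = step_prob p x true * (\sum_(w <- words m | hits a x.+1 w) word_prob p x.+1 w)
   + step_prob p x false * (\sum_(w <- words m | hits a x.-1 w) word_prob p x.-1 w).
  by rewrite !big_distrr /= [in RHS]big_mkcond [X in _ = _ + X]big_mkcond.
rewrite [leLHS]mulrDl -[step_prob p x true * _ * _]mulrA -[step_prob p x false * _ *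
    _]mulrA.
apply: (@le_trans _ _ (transition p (twocosh l) x * expR ((2 + 8 * c) * l ^+ 2 *
    m%:R))).
  rewrite /transition [leRHS]mulrDl -[step_prob p x true * _ * _]mulrA -[step_prob p
      x false * _ * _]mulrA.
  apply: lerD; (apply: ler_wpM2l; first exact: step_prob_ge0); exact: IH.
apply: le_trans (ler_wpM2r (expR_ge0 _) (twocosh_step x l01)) _.
rewrite le_eqVlt; apply/orP; left; apply/eqP.
have -> : (2 + 8 * c) * l ^+ 2 * m.+1%:R =
  (2 + 8 * c) * l ^+ 2 + (2 + 8 * c) * l ^+ 2 * m%:R by rewrite -natr1; ring.
by rewrite expRD; ring.
Qed.

(** By Borel-Cantelli the level [a k], of order sqrt (2^k ln k), is reached before time 2^(k+1) for
    finitely many k only. For 2^k <= n < 2^(k+1) with k >= 4, ln k <= 2 ln (ln n). *)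
Lemma upper_LIL d (T : measurableType d) (P : probability T R) (w : nat -> T ->
    seq bool) :
  word_process P p w -> exists2 A : R, 0 <= A &
  {ae P, forall u, exists n0, forall n, (n0 <= n)%N ->
    (walk_pos 0 (w n u))%:R ^+ 2 <= A * (n%:R * ln (ln n%:R))}.
Proof.
move=> wP; pose K := 2 + 8 * c.
have K0 : 0 <= K by rewrite /K addr_ge0// mulr_ge0.
pose l k : R := Num.sqrt (ln k%:R / 2 ^+ k).
have lnk0 k : 0 <= ln (k%:R : R).
  by case: k => [|k]; [rewrite ln0|rewrite ln_ge0// ler1n].
have l2 k : l k ^+ 2 = ln k%:R / 2 ^+ k by rewrite sqr_sqrtr// divr_ge0// exprn_ge0.
have k2 k : 0 < (2 : R) ^+ k by rewrite exprn_gt0.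
have l01 k : 0 <= l k <= 1.
  rewrite sqrtr_ge0 -[leRHS]sqrtr1 ler_wsqrtr// ler_pdivrMr// mul1r.
  case: k => [|k]; first by rewrite ln0.
  apply: (@le_trans _ _ k.+1%:R); first by rewrite ltW// ln_sublinear// ltr0n.
  by rewrite -natrX ler_nat ltnW// ltn_expl.
(* Chosen so that the exponent K l^2 2^(k+1) - l a from [hits_bound] is 2 K ln k - (2 K + 2) ln k =
   -2 ln k. *)
pose a k : R := (2 * K + 2) * l k * 2 ^+ k.
have a0 k : 0 <= a k.
  by rewrite /a mulr_ge0 ?exprn_ge0// mulr_ge0//; [lra|case/andP: (l01 k)].
pose F k := [set u | hits (a k) 0 (w (2 ^ k.+1)%N u)].
have mF k := word_process_event wP (2 ^ k.+1)%N (hits (a k) 0).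
pose r k : R := 2 * expR (- (2 * ln k%:R)).
have PF k : (P (F k) <= (r k)%:E)%E.
  rewrite (mF k).2 lee_fin.
  have := hits_bound (a k) 0 (2 ^ k.+1)%N (l01 k).
  rewrite -ler_pdivlMr ?expR_gt0// => /le_trans; apply.
  rewrite /twocosh mulr0 oppr0 expR0 -[leLHS]mulrA -expRN -expRD /r.
  rewrite ler_wpM2l// ler_expR /a -/K l2.
  have -> : l k * ((2 * K + 2) * l k * 2 ^+ k) = (2 * K + 2) * (l k ^+ 2 * 2 ^+ k) by
      ring.
  rewrite l2 natrX exprS divfK ?gt_eqF//.
  have -> : K * (ln k%:R / 2 ^+ k) * (2 * 2 ^+ k) = 2 * K * (ln k%:R / 2 ^+ k * 2 ^+
      k) by ring.
  by rewrite divfK ?gt_eqF//; lra.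
have rS k : r k.+1 = 2 / k.+1%:R ^+ 2.
  by rewrite /r expRN expRM_natl lnK// posrE ltr0n.
(* By the convention ln 0 = 0, r 0 = 2; the terms 2/k^2 with k >= 1 are at most 4/k - 4/(k + 1),
   which telescopes. *)
have rM n : \sum_(k < n) r k <= 6.
  case: n => [|n]; first by rewrite big_ord0.
  apply: (@le_trans _ _ (6 - 4 / n.+1%:R)); last first.
    by rewrite gerBl divr_ge0.
  elim: n => [|n IH].
    by rewrite big_ord1 /r ln0// mulr0 oppr0 expR0 divr1; lra.
  rewrite big_ord_recr /= rS; apply: le_trans (lerD IH (lexx _)) _.
  rewrite -addrA lerD2l -subr_ge0.
  have -> : - (4 / n.+2%:R) - (- (4 / n.+1%:R) + 2 / n.+1%:R ^+ 2) =
     2 * n%:R / (n.+1%:R ^+ 2 * n.+2%:R) :> R.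
    by rewrite -[n.+2%:R]natr1 -[n.+1%:R]natr1; field;
        rewrite !gt_eqF// !ltr_wpDl// addr_ge0.
  by rewrite divr_ge0 ?mulr_ge0 ?exprn_ge0.
pose A := 2 * (2 * K + 2) ^+ 2.
have A0 : 0 <= A by rewrite /A mulr_ge0 ?sqr_ge0.
exists A => //.
apply: filterS (ae_eventually (fun k => (mF k).1) PF rM) => u [K1 K1P].
exists (2 ^ (maxn K1 4))%N => n nn.
have n0 : (0 < n)%N by apply: leq_trans nn; rewrite expn_gt0.
pose k := trunc_log 2 n.
have /andP[kn nk] : (2 ^ k <= n < 2 ^ k.+1)%N by apply: trunc_log_bounds.
have : (maxn K1 4 <= k)%N by rewrite /k -(@trunc_expnK 2 (maxn K1 4))// leq_trunc_log.
rewrite geq_max => /andP[kK1 k4].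
have /negP nh := K1P k kK1.
have := not_hits_take n nh; rewrite (word_process_take wP _ (ltnW nk)) => Xa.
have X0 : 0 <= (walk_pos 0 (w n u))%:R :> R by rewrite ler0n.
apply: (@le_trans _ _ (a k ^+ 2)).
  by apply: lerXn2r; rewrite ?nnegrE ?a0// ltW.
have -> : a k ^+ 2 = (2 * K + 2) ^+ 2 * (l k ^+ 2 * 2 ^+ k * 2 ^+ k) by rewrite /a;
    ring.
rewrite l2 divfK ?gt_eqF//.
have -> : A * (n%:R * ln (ln n%:R)) = (2 * K + 2) ^+ 2 * (2 * ln (ln n%:R) * n%:R).
  by rewrite /A; ring.
apply: ler_wpM2l; first exact: sqr_ge0.
have ln2 : 2^-1 <= ln (2 : R).
  by have := @ln_ge_1V R 2 (ltr0n _ 2); lra.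
have k0 : 4 <= (k%:R : R) by rewrite ler_nat.
have lnn : k%:R / 2 <= ln (n%:R : R).
  apply: (@le_trans _ _ (ln (2 ^+ k))).
    by rewrite lnXn// -[leRHS]mulr_natl ler_wpM2l.
  by rewrite ler_ln ?posrE// ?ltr0n// -natrX ler_nat.
(* Uses ln n >= k/2, and (k/2)^2 >= k, which holds as k >= 4. *)
have lnk : ln (k%:R : R) <= 2 * ln (ln n%:R).
  apply: (@le_trans _ _ (2 * ln (k%:R / 2))); last first.
    by rewrite ler_wpM2l// ler_ln ?posrE//; lra.
  rewrite [leRHS]mulr_natl -lnXn; last by lra.
  rewrite ler_ln ?posrE ?exprn_gt0//; try lra.
  have -> : (k%:R / 2) ^+ 2 = k%:R * (k%:R / 4) :> R by field.
  by rewrite ler_peMr//; lra.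
apply: ler_pM; [exact: lnk0|exact/ltW/k2|exact: lnk|].
by rewrite -natrX ler_nat.
Qed.

End UpperLIL.

(** * The two growth estimates *)

(** The power 1 - gamma/2 of (s1 + s2)^2 <= 2 (s1^2 + s2^2). *)
Lemma powR_BigO (R : realType) (gamma A1 A2 s1 s2 L : R) : gamma <= 2 ->
  0 <= A1 -> 0 <= A2 -> 0 <= s1 -> 0 <= s2 -> 0 <= L ->
  s1 ^+ 2 <= A1 * L -> s2 ^+ 2 <= A2 * L ->
  (s1 + s2) `^ (2 - gamma) <= (2 * (A1 + A2)) `^ (1 - gamma / 2) * L `^ (1 - gamma / 2).
Proof.
move=> g2 A10 A20 s10 s20 L0 h1 h2.
have -> : 2 - gamma = 2 * (1 - gamma / 2) by lra.
rewrite powRrM (_ : (s1 + s2) `^ 2 = (s1 + s2) ^+ 2); last first.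
  by rewrite -powR_mulrn// addr_ge0.
rewrite -powRM ?mulr_ge0 ?addr_ge0//.
have g0 : 0 <= 1 - gamma / 2 by lra.
apply: (ge0_ler_powR g0); rewrite ?nnegrE ?sqr_ge0 ?mulr_ge0 ?addr_ge0//.
by have := sqr_ge0 (s1 - s2); lra.
Qed.

Theorem theorem1p3 (R : realType) (B gamma C : R) (p1 p2 : nat -> R)
  (hB : 1 < B) (hgamma1 : 1 < gamma) (hgamma2 : gamma <= 2) (hC : 0 <= C)
  (hp1 : forall j : nat, (1 <= j)%N -> 0 <= p1 j <= 2^-1)
  (hp2 : forall j : nat, (1 <= j)%N -> 0 <= p2 j <= 2^-1)
  (hB1 : forall j : nat, (1 <= j)%N ->
     `|p1 j - B / (4 * j%:R)| <= C / (j%:R `^ gamma))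
  (hB2 : forall j : nat, (1 <= j)%N ->
     `|p2 j - B / (4 * j%:R)| <= C / (j%:R `^ gamma)) :
  exists (d : measure_display) (T : measurableType d) (P : probability T R)
    (X1 X2 : nat -> {RV P >-> nat}),
    [/\ nn_walk p1 X1,
        nn_walk p2 X2 &
        {ae P, forall w,
          ((fun n : nat => `|(X1 n w)%:R - (X2 n w)%:R| : R^o) =O_\oo
           (fun n : nat => ((X1 n w)%:R + (X2 n w)%:R) `^ (2 - gamma) : R^o)) /\
          ((fun n : nat => ((X1 n w)%:R + (X2 n w)%:R) `^ (2 - gamma) : R^o) =O_\oo
           (fun n : nat => (n%:R * ln (ln n%:R)) `^ (1 - gamma / 2) : R^o))}].
Proof.
have N1 : bessel_like B gamma C p1 by [].
have N2 : bessel_like B gamma C p2 by [].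
have [d [T [P [w1 [w2 [t [F [c [W1 W2 [t0 tS] FP Fd]]]]]]]]] :=
  coupled_words hB hgamma1 hgamma2 hC N1 N2.
have [X1 X1E] := word_process_rv W1.
have [X2 X2E] := word_process_rv W2.
exists d, T, P, X1, X2; split.
- exact: (word_process_walk W1 X1E).
- exact: (word_process_walk W2 X2E).
have c0 : 0 <= B / 4 + C by lra.
have pc p : bessel_like B gamma C p -> forall x, (1 <= x)%N -> p x * x%:R <= B / 4 + C.
  move=> pN x x1; rewrite -ler_pdivlMr ?ltr0n//.
  exact: (bessel_like_bnd hB hgamma1 hC pN x1).
have [A1 A10 L1] := upper_LIL N1.1 c0 (pc _ N1) W1.
have [A2 A20 L2] := upper_LIL N2.1 c0 (pc _ N2) W2.
have Fs n : \sum_(k < n) c * 2^-1 ^+ k <= 2 * `|c|.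
  apply: (@le_trans _ _ (2 * `|c| - 2 * `|c| * 2^-1 ^+ n)); last first.
    by rewrite gerBl mulr_ge0// exprn_ge0.
  elim: n => [|n IH]; first by rewrite big_ord0 expr0 mulr1 subrr.
  rewrite big_ord_recr /=; apply: le_trans (lerD IH (lexx _)) _.
  have : c * 2^-1 ^+ n <= `|c| * 2^-1 ^+ n.
    by rewrite ler_wpM2r ?exprn_ge0// ler_norm.
  by rewrite exprS; lra.
have AE := ae_eventually (fun k => (FP k).1) (fun k => (FP k).2) Fs.
apply: filterS3 AE L1 L2 => u [K KP] [n1 n1P] [n2 n2P]; split.
  have tn n : (n <= t n)%N.
    by elim: n => // n IH; apply: leq_ltn_trans IH (tS n).
  pose D := gap (walk_pos 0 (w1 (t K) u)) (walk_pos 0 (w2 (t K) u)).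
  have Dt j : (gap (walk_pos 0 (w1 (t (K + j)%N) u)) (walk_pos 0 (w2 (t (K + j)%N)
      u)) <= D)%N.
    elim: j => [|j IH]; first by rewrite addn0.
    rewrite addnS; apply: leq_trans IH; apply: Fd; first exact/KP/leq_addr.
    by rewrite leqnn ltnW.
  have DD n : (t K <= n)%N -> (gap (walk_pos 0 (w1 n u)) (walk_pos 0 (w2 n u)) <= D)%N.
    move=> tKn; have [j /andP[j1 j2]] : exists j, (t (K + j) <= n <= t (K + j).+1)%N.
      have [i] : exists i, (n <= t (K + i))%N.
        by exists n; apply: leq_trans (tn _); exact: leq_addl.
      elim: i => [|j IH] h.
        exists 0%N; rewrite addn0 in h *; rewrite tKn /=.
        exact: leq_trans h (ltnW (tS _)).
      case: (leqP n (t (K + j))) => h'; first exact: IH.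
      by exists j; rewrite (ltnW h') -addnS.
    apply: leq_trans (Dt j); apply: Fd; first exact/KP/leq_addr.
    by rewrite j1.
  (* The constant must be positive, and D, the distance at the start of the first block after the
     last failure, may be 0. *)
  apply/eqO_exP; exists (D.+1%:R); first by rewrite ltr0n.
  exists (t K) => // n /= /DD; rewrite !X1E !X2E /gap.
  move: (walk_pos 0 (w1 n u)) (walk_pos 0 (w2 n u)) => x y xyD.
  rewrite normr_id [X in _ * X]ger0_norm ?powR_ge0//.
  have -> : `|x%:R - y%:R| = (x - y + (y - x))%:R :> R.
    case: (leqP x y) => [|/ltnW] h.
      by rewrite distrC (eqP h) add0n -natrB// normr_nat.
    by rewrite (eqP h) addn0 -natrB// normr_nat.
  (* Either both walks are at 0 and the difference vanishes, or their sum is at least 1, and so is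
     its power. *)
  have [S0|S0] := posnP (x + y); first by move: S0; case: x xyD => // ; case: y =>
      //= *; rewrite mulr_ge0// powR_ge0.
  apply: (@le_trans _ _ (D.+1%:R * 1)); first by rewrite mulr1 ler_nat ltnW.
  apply: ler_wpM2l => //; rewrite -natrD.
  apply: (@le_trans _ _ (1 `^ (2 - gamma))); first by rewrite powR1.
  have g0 : 0 <= 2 - gamma by lra.
  by apply: (ge0_ler_powR g0); rewrite ?nnegrE ?ler1n.
apply/eqO_exP; exists ((2 * (A1 + A2)) `^ (1 - gamma / 2) + 1).
  by rewrite ltr_wpDl// powR_ge0.
(* For n >= e the iterated logarithm is nonnegative. *)
have [n3 n3P] := nat_ge_real (expR (1 : R)).
exists (maxn n3 (maxn n1 n2)) => // n /=; rewrite !geq_max => /and3P[n3n n1n n2n].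
rewrite !ger0_norm ?powR_ge0// X1E X2E.
have n0 : expR 1 <= (n%:R : R) by apply: le_trans n3P _; rewrite ler_nat.
have L0 : 0 <= n%:R * ln (ln n%:R) :> R.
  have n1' : 0 < (n%:R : R) := lt_le_trans (expR_gt0 1) n0.
  have : ln (expR 1) <= ln (n%:R : R) by rewrite ler_ln ?posrE ?expR_gt0.
  by rewrite expRK => h; rewrite mulr_ge0// ln_ge0.
apply: le_trans (powR_BigO hgamma2 A10 A20 _ _ L0 (n1P _ n1n) (n2P _ n2n)) _ => //.
by rewrite ler_wpM2r ?powR_ge0// lerDl.
Qed.
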